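(* Let $X$ be a Banach space. Then the following assertions are equivalent: (i) $X$ is Asplund. (ii) $(X,|\cdot|)^*$ has a $1$-projectional skeleton for every equivalent norm $|\cdot|$ on $X$. (iii) $(B_{(X,|\cdot|)^{**}},w^* )$ has a retractional skeleton for every equivalent norm $|\cdot|$ on $X$.
   Context: All topological spaces are Hausdorff; Banach spaces are real. $B_Z$ denotes the closed unit ball of a Banach space $Z$; $w^*$ is the weak$^*$ topology, on $X^{**}=(X^* )^*$ the one induced by $X^*$. $(X,|\cdot|)^*$ and $(X,|\cdot|)^{**}$ carry the dual and bidual norms of $|\cdot|$. A Banach space is Asplund if every separable subspace has separable dual. A partially ordered set $\Gamma$ is up-directed if any two elements have an upper bound in $\Gamma$, and $\sigma$-complete if every increasing sequence in $\Gamma$ has a supremum in $\Gamma$. A projectional skeleton in a Banach space $Z$ is a family $\{P_s\}_{s\in\Gamma}$ of bounded linear projections on $Z$, indexed by an up-directed $\sigma$-complete partially ordered set $\Gamma$, such that: (i) each $P_sZ$ is separable; (ii) $Z=\bigcup_{s\in\Gamma}P_sZ$; (iii) $s\le t\Rightarrow P_s=P_s\circ P_t=P_t\circ P_s$; (iv) if $s_1<s_2<\cdots$ in $\Gamma$ and $t=\sup_n s_n$, then $P_tZ=\overline{\bigcup_n P_{s_n}Z}$. It is an $r$-projectional skeleton ($r\ge1$) if moreover $\|P_s\|\le r$ for all $s\in\Gamma$. A retractional skeleton in a compact space $K$ is a family $\{r_s\}_{s\in\Gamma}$ of (continuous) retractions of $K$ into itself, indexed by an up-directed $\sigma$-complete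 partially ordered set $\Gamma$, such that: (i) $r_s[K]$ is metrizable for each $s$; (ii) $x=\lim_{s\in\Gamma}r_s(x)$ for every $x\in K$; (iii) $s\le t\Rightarrow r_s=r_s\circ r_t=r_t\circ r_s$; (iv) if $s_1<s_2<\cdots$ in $\Gamma$ and $t=\sup_n s_n$, then $r_t(x)=\lim_n r_{s_n}(x)$ for every $x\in K$. *)

(* Defs.v *)
(* The scalar field is an arbitrary [R : realType]. *)
From HB Require Import structures.
From mathcomp Require Import all_boot all_order all_algebra.
From mathcomp Require Import all_classical all_reals all_analysis.

Set Implicit Arguments.
Unset Strict Implicit.
Unset Printing Implicit Defensive.

Import Order.TTheory GRing.Theory Num.Theory.
Import numFieldNormedType.Exports.

Local Open Scope classical_set_scope.
Local Open Scope ring_scope.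

Section OperatorNorm.
Context {R : realType} {V W : normedModType R}.

(* A supremum of reals: only meaningful when [f] is bounded on the unit ball
   (an unbounded [f] gets the junk value 0). *)
Definition opnorm (f : V -> W) : R :=
  sup [set `|f x| | x in [set x : V | `|x| <= 1]].

Let opset (f : V -> W) := [set `|f x| | x in [set x : V | `|x| <= 1]].

Lemma opnorm_has_sup (f : {linear V -> W}) : continuous f -> has_sup (opset f).
Proof.
move=> /linear_bounded_continuous/linear_boundedP/pinfty_ex_gt0[M M0 fM].
split; first by exists `|f 0|, 0 => //=; rewrite normr0.
exists M => _ [x /= x1 <-]; apply: le_trans (fM x) _.
by rewrite ler_piMr// ltW.
Qed.

Lemma opnormP (f : {linear V -> W}) (x : V) :
  continuous f -> `|f x| <= opnorm f * `|x|.
Proof.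
move=> /opnorm_has_sup [_ ub].
have [->|x0] := eqVneq x 0; first by rewrite linear0 !normr0 mulr0.
have nx : 0 < `|x| by rewrite normr_gt0.
rewrite -ler_pdivrMr// mulrC -[X in X * _]gtr0_norm ?invr_gt0//.
rewrite -normrZ -linearZ; apply: ub_le_sup => //=.
by exists (`|x|^-1 *: x) => //=; rewrite normrZ gtr0_norm ?invr_gt0// mulVf ?gt_eqF.
Qed.

Lemma opnorm_le (f : V -> W) (M : R) :
  (forall x, `|x| <= 1 -> `|f x| <= M) -> opnorm f <= M.
Proof.
move=> fM; apply: ge_sup; first by exists `|f 0|, 0 => //=; rewrite normr0.
by move=> _ [x /= x1 <-]; exact: fM.
Qed.

End OperatorNorm.

Section Dual.
Context {R : realType} (V : normedModType R).

Definition functional : {pred V -> R^o} :=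
  [pred f : V -> R^o | `[< linear f /\ continuous f >]].

Record dual := Dual { dual_fun :> V -> R^o; dual_funP : dual_fun \in functional }.

HB.instance Definition _ := [isSub for dual_fun].
HB.instance Definition _ := [Choice of dual by <:].

Lemma functional_submod_closed : submod_closed functional.
Proof.
split=> [|a f g /asboolP[lf cf] /asboolP[lg cg]]; apply/asboolP; split.
- by move=> a x y /=; rewrite scaler0 addr0.
- by move=> x; exact: cvg_cst.
- move=> b x y /=.
  change (a *: f (b *: x + y) + g (b *: x + y) =
    b *: (a *: f x + g x) + (a *: f y + g y)).
  rewrite lf lg scalerDr addrACA; congr (_ + _).
  by rewrite scalerDr !scalerA mulrC.
- by move=> x; apply: cvgD; [apply: cvgZl_tmp; exact: cf | exact: cg].
Qed.

HB.instance Definition _ :=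
  GRing.isSubmodClosed.Build R (V -> R^o) functional functional_submod_closed.
HB.instance Definition _ := [SubChoice_isSubLmodule of dual by <:].

HB.instance Definition _ (f : dual) := @GRing.isLinear.Build R V R^o *:%R f
  (proj1 (asboolW (dual_funP f))).

Lemma dual_continuous (f : dual) : continuous f.
Proof. exact: (proj2 (asboolW (dual_funP f))). Qed.

Lemma dualD (f g : dual) x : (f + g) x = f x + g x.
Proof. by []. Qed.

Lemma dualZ (a : R) (f : dual) x : (a *: f) x = a *: f x.
Proof. by []. Qed.

Let dual_norm (f : dual) : R := opnorm f.

Let dual_normP (f : dual) x : `|f x| <= dual_norm f * `|x|.
Proof. exact/opnormP/dual_continuous. Qed.

Let dual_normD (f g : dual) : dual_norm (f + g) <= dual_norm f + dual_norm g.
Proof.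
have le1 (h : dual) x : `|x| <= 1 -> `|h x| <= dual_norm h.
  move=> x1; apply: ub_le_sup; last by exists x.
  by case: (opnorm_has_sup (@dual_continuous h)).
apply: opnorm_le => x x1; rewrite dualD.
by apply: le_trans (ler_normD _ _) _; rewrite lerD// le1.
Qed.

Let dual_norm_leZ (a : R) (f : dual) : dual_norm (a *: f) <= `|a| * dual_norm f.
Proof.
apply: opnorm_le => x x1; rewrite dualZ normrZ ler_wpM2l//.
apply: ub_le_sup; last by exists x.
by case: (opnorm_has_sup (@dual_continuous f)).
Qed.

Let dual_normZ (a : R) (f : dual) : dual_norm (a *: f) = `|a| * dual_norm f.
Proof.
apply/eqP; rewrite eq_le dual_norm_leZ/=.
have [->|a0] := eqVneq a 0.
  rewrite normr0 mul0r; apply: le_trans (normr_ge0 ((0 *: f) (0 : V))) _.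
  apply: ub_le_sup; last by exists 0 => //=; rewrite normr0.
  by case: (opnorm_has_sup (@dual_continuous (0 *: f))).
rewrite mulrC -ler_pdivlMr ?normr_gt0// mulrC -normfV.
by rewrite -{1}(scale1r f) -(mulVf a0) -scalerA dual_norm_leZ.
Qed.

Let dual_norm0 (f : dual) : dual_norm f = 0 -> f = 0.
Proof.
move=> f0; apply/val_inj/funext => x /=; apply/eqP.
by rewrite -normr_le0; apply: le_trans (dual_normP f x) _; rewrite f0 mul0r.
Qed.

HB.instance Definition _ :=
  Lmodule_isNormed.Build R dual dual_normD dual_normZ dual_norm0.

Lemma dual_normE (f : dual) : `|f| = opnorm f.
Proof. by []. Qed.

Lemma dual_normP' (f : dual) x : `|f x| <= `|f| * `|x|.
Proof. exact: dual_normP. Qed.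

Let dual_complete (F : set_system dual) : ProperFilter F -> cauchy F -> cvg F.
Proof.
move=> FF /cauchyP Fc.
have ev_cvg x : cvg ((fun f : dual => f x) @ F).
  apply: cauchy_cvg; apply: cauchy_exP => e e0.
  have d0 : 0 < e / (`|x| + 1) by rewrite divr_gt0// ltr_wpDl.
  have [f0 Ff0] := Fc _ d0; exists (f0 x).
  change (F [set f : dual | ball (f0 x : R^o) e (f x)]).
  apply: filterS Ff0 => f /=.
  rewrite -!ball_normE /= => f0f.
  have -> : f0 x - f x = (f0 - f) x by [].
  apply: le_lt_trans (dual_normP' _ _) _.
  apply: (@le_lt_trans _ _ (`|f0 - f| * (`|x| + 1))).
    by rewrite ler_wpM2l// lerDl.
  by rewrite -ltr_pdivlMr// ltr_wpDl.
pose g (x : V) : R^o := lim ((fun f : dual => f x) @ F).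
have gE x : (fun f : dual => f x) @ F --> g x by exact: ev_cvg.
have lg : linear g.
  move=> a x y; apply/cvg_lim => //.
  under eq_fun do rewrite linearP.
  by apply: cvgD; [apply: cvgZl_tmp; exact: gE | exact: gE].
have gclose e (f0 : dual) : 0 < e -> F (ball f0 e) ->
    forall x, `|f0 x - g x| <= e * `|x|.
  move=> e0 Ff0 x.
  have h : (fun f : dual => `|f0 x - f x|) @ F --> `|f0 x - g x|.
    by apply: cvg_norm; apply: cvgB; [exact: cvg_cst | exact: gE].
  rewrite -(cvg_lim _ h)//; apply: limr_le; first by apply/cvg_ex; eexists; exact: h.
  apply: filterS Ff0 => f; rewrite -ball_normE /= => f0f.
  have -> : f0 x - f x = (f0 - f) x by [].
  by apply: le_trans (dual_normP' _ _) _; rewrite ler_wpM2r// ltW.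
pose g' : {linear V -> R^o} := HB.pack g (GRing.isLinear.Build _ _ _ _ g lg).
have cg : continuous g.
  apply: (@bounded_linear_continuous _ _ _ g'); apply/linear_boundedP.
  have [f0 Ff0] := Fc _ (ltr01 : 0 < 1 :> R).
  near=> M => x.
  have := gclose _ _ ltr01 Ff0 x; rewrite mul1r => fg.
  rewrite /= -(subKr (f0 x) (g x)).
  apply: le_trans (ler_normB _ _) _.
  apply: (@le_trans _ _ ((`|f0| + 1) * `|x|)).
    by rewrite mulrDl mul1r lerD// dual_normP'.
  by rewrite ler_wpM2r//; near: M; apply: nbhs_pinfty_ge; exact: num_real.
have gP : g \in functional by apply/asboolP; split.
apply/cvg_ex; exists (Dual gP); apply/cvgrPdist_lt => e e0.
have e20 : 0 < e / 2 by rewrite divr_gt0.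
have [f0 Ff0] := Fc _ e20; apply: filterS (Ff0) => f; rewrite -ball_normE /= => f0f.
rewrite -(subrKA f0) (splitr e); apply: le_lt_trans (ler_normD _ _) _.
apply: ler_ltD => //.
rewrite distrC dual_normE; apply: opnorm_le => x x1.
apply: le_trans (gclose _ _ e20 Ff0 x) _.
by rewrite ler_piMr// ltW.
Unshelve. all: by end_near. Qed.

HB.instance Definition _ := Uniform_isComplete.Build dual dual_complete.

End Dual.

(* [(X, N)]: the carrier of [X] with the norm [N] in place of [`| _ |]. *)
Section Renorming.
Context {R : realType} {X : normedModType R}.

Record equivalent_norm := EquivalentNorm {
  eqnorm :> X -> R;
  eqnormD : forall x y, eqnorm (x + y) <= eqnorm x + eqnorm y;
  eqnormZ : forall (a : R) x, eqnorm (a *: x) = `|a| * eqnorm x;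
  eqnorm0_eq0 : forall x, eqnorm x = 0 -> x = 0;
  eqnorm_equiv : exists c C : R, [/\ 0 < c, 0 < C &
    forall x, c * `|x| <= eqnorm x <= C * `|x|]
}.

Definition renorm (N : equivalent_norm) : Type := X.

HB.instance Definition _ N := GRing.Lmodule.on (renorm N).
HB.instance Definition _ (N : equivalent_norm) :=
  Lmodule_isNormed.Build R (renorm N) (@eqnormD N) (@eqnormZ N) (@eqnorm0_eq0 N).

End Renorming.

Arguments equivalent_norm {R} X.

Section Subspace.
Context {R : realType} {X : normedModType R} (U : submodClosed X).

Record subspace_of := SubspaceOf {
  subspace_val : X; subspace_valP : subspace_val \in U }.

HB.instance Definition _ := [isSub for subspace_val].
HB.instance Definition _ := [Choice of subspace_of by <:].
HB.instance Definition _ := [SubChoice_isSubLmodule of subspace_of by <:].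

Let subspace_norm (x : subspace_of) : R := `|val x|.

Let subspace_normD x y :
  subspace_norm (x + y) <= subspace_norm x + subspace_norm y.
Proof. exact: ler_normD. Qed.

Let subspace_normZ (a : R) x : subspace_norm (a *: x) = `|a| * subspace_norm x.
Proof. exact: normrZ. Qed.

Let subspace_norm0 x : subspace_norm x = 0 -> x = 0.
Proof. by move=> /normr0_eq0 x0; apply: val_inj. Qed.

HB.instance Definition _ := Lmodule_isNormed.Build R subspace_of
  subspace_normD subspace_normZ subspace_norm0.

End Subspace.

Definition separable {T : topologicalType} (A : set T) :=
  exists D : set T, [/\ countable D, D `<=` A & A `<=` closure D].

(* As usual for Banach spaces, subspaces are closed. *)
Definition asplund {R : realType} (X : completeNormedModType R) :=
  forall U : submodClosed X, closed [set` U] -> separable [set` U] ->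
    separable [set: dual (subspace_of U)].

Section IndexSet.
Context {d : Order.disp_t} (G : porderType d).

(* Nonemptiness is part of directedness, so that limits along [G] make sense. *)
Definition up_directed :=
  inhabited G /\ forall s t : G, exists u : G, (s <= u)%O /\ (t <= u)%O.

Definition sigma_complete :=
  forall u : nat -> G, nondecreasing_seq u -> exists t, supremums (range u) t.

(* The filter of tails of [G], along which nets indexed by [G] converge. *)
Definition tails : set_system G := filter_from setT (fun s => [set t | (s <= t)%O]).

End IndexSet.

Arguments tails {d} G.

Section ProjectionalSkeleton.
Context {R : realType} (Z : completeNormedModType R).

Record projectional_skeleton (d : Order.disp_t) (G : porderType d)
    (P : G -> {linear Z -> Z}) : Prop := {
  psk_directed : up_directed G;
  psk_sigma_complete : sigma_complete G;
  psk_continuous : forall s, continuous (P s);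
  psk_projection : forall s, P s \o P s = P s;
  psk_separable : forall s, separable (range (P s));
  psk_cover : [set: Z] = \bigcup_s range (P s);
  psk_compat : forall s t, (s <= t)%O ->
    (P s : Z -> Z) = P s \o P t /\ (P s : Z -> Z) = P t \o P s;
  psk_sup : forall (u : nat -> G) t, increasing_seq u -> supremums (range u) t ->
    range (P t) = closure (\bigcup_n range (P (u n)))
}.

Definition has_projectional_skeleton (r : R) :=
  exists (d : Order.disp_t) (G : porderType d) (P : G -> {linear Z -> Z}),
    projectional_skeleton P /\ forall s, opnorm (P s) <= r.

End ProjectionalSkeleton.

Definition metrizable (R : realType) (T : topologicalType) :=
  exists dist : T -> T -> R,
    [/\ forall x y, dist x y = 0 <-> x = y,
        forall x y, dist x y = dist y x,
        forall x y z, dist x z <= dist x y + dist y z &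
        forall x : T, nbhs x =
          filter_from [set e : R | 0 < e] (fun e => [set y | dist x y < e])].

Section RetractionalSkeleton.
Context (R : realType) (K : topologicalType).

Record retractional_skeleton (d : Order.disp_t) (G : porderType d)
    (r : G -> K -> K) : Prop := {
  rsk_directed : up_directed G;
  rsk_sigma_complete : sigma_complete G;
  rsk_continuous : forall s, continuous (r s);
  rsk_retraction : forall s, r s \o r s = r s;
  rsk_metrizable : forall s, metrizable R (range (r s));
  rsk_cvg : forall x, r s x @[s --> tails G] --> x;
  rsk_compat : forall s t, (s <= t)%O -> r s = r s \o r t /\ r s = r t \o r s;
  rsk_sup : forall (u : nat -> G) t, increasing_seq u -> supremums (range u) t ->
    forall x, r (u n) x @[n --> \oo] --> r t x
}.

Definition has_retractional_skeleton :=
  exists (d : Order.disp_t) (G : porderType d) (r : G -> K -> K),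
    retractional_skeleton r.

End RetractionalSkeleton.

(* [V^*] with its weak-star topology: pointwise convergence on [V]. *)
Definition weak_star {R : realType} (V : normedModType R) : Type := dual V.

HB.instance Definition _ (R : realType) (V : normedModType R) :=
  Topological.copy (weak_star V)
    (initial_topology (fun f : dual V => (f : {ptws V -> R^o}))).

Definition bidual_ball {R : realType} (V : normedModType R) :
  set (weak_star (dual V)) := [set F : dual (dual V) | `|F| <= 1].

Arguments bidual_ball {R} V.

(* Main.v *)
From HB Require Import structures.
Require Import Defs.
From mathcomp Require Import all_boot all_order all_algebra.
From mathcomp Require Import all_classical all_reals all_analysis.

Set Implicit Arguments.
Unset Strict Implicit.
Unset Printing Implicit Defensive.

Import Order.TTheory GRing.Theory Num.Theory.
Import numFieldNormedType.Exports.

Local Open Scope classical_set_scope.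
Local Open Scope ring_scope.

(** Write [V] for [X] with an equivalent norm.

    From Asplund to projections.  If some bounded set of functionals had no
    nonempty relatively weak-star open piece of small diameter, it could be
    split again and again along a binary tree of points of [X]; weak-star
    compactness then gives a functional for each branch, any two of them far
    apart on the countable set of nodes ([cantor_tree]), so the closed span of
    the nodes would be a separable subspace with nonseparable dual.  Hence
    every bounded part of the dual is fragmented ([asplund_fragmented]).
    Peeling off small open pieces transfinitely exhausts a dual ball by a
    decreasing well-ordered tower of weak-star compact sets.  A box [C] (finitely
    many points, rational bounds) determines the last tower member [L] that it
    meets, and [L] meets [C] in a set with a finite net, the next member being
    disjoint from [C].  These nets are attached to finite sets of points of [V]
    once and for all.  Given any set [A] of points and any functional [f], take
    among the boxes over [A] that contain [f] in their interior one for which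
    the tower member is as large as possible; shrinking the box no longer
    changes the member, so by compactness it contains a [g] in the box that
    agrees with [f] on [A], and [g] is close to the net of this box
    ([box_approx], [dual_nets]).

    Now let [A] be countable and closed under choosing vectors that norm the
    rational combinations of net functionals over [A].  On the closure [Y_A] of
    these functionals, restriction to [A] is injective and isometric, and every
    functional agrees on [A] with a unique member of [Y_A].  Sending a
    functional to that member is a projection of norm one onto [Y_A]; these
    projections, indexed by the sets [A] ordered by inclusion, form the
    skeleton ([fragmented_skeleton]).  The nets depend on finitely many points
    only, which gives continuity along increasing unions; taking for [A] the
    whole space shows that the [Y_A] cover the dual.

    From projections to retractions.  The retractions are the adjoints
    [F |-> F \o P_s] restricted to the bidual ball
    ([dual_retractional_skeleton]).

    From retractions to Asplund.  Let [U] be a separable subspace with dense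
    sequence [a_n], let [pi_n = id - xs_n(.) a_n / |a_n|] be the projections
    killing [a_n], where [xs_n] norms [a_n], and renorm by
    [|x| + sum_n 2^-(n+1) |pi_n x|].  If [x] in [U] has new norm one and [F] in
    the bidual ball takes the values of [x] at countably many suitable
    functionals, then the summands of the bidual norm leave [F] no room:
    [|F - x|] is at most [2 |pi_n x|] up to a constant, for every [n], and this
    is small when [a_n] is close to [x].  So [x] is a weak-star G-delta point of
    the ball ([unit_vector_determined]) and lies in the range of some retraction
    ([determined_in_range]).  One retraction fixes all normalized [a_n]; its
    range is compact and metrizable, so the functionals restricted to it are
    separable in the uniform norm, and that dominates the norm of their
    restrictions to [U] ([retractional_skeletons_asplund]). *)

(** * Weak-star convergence *)

Lemma initial_cvg (S : choiceType) (T : topologicalType) (f : S -> T)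
    (F : set_system S) (s : S) : Filter F ->
  f @ F --> f s -> F --> (s : initial_topology f).
Proof.
move=> FF fF U; rewrite nbhsE => -[B [[C oC CB] Bs] BU].
apply: (filterS BU); rewrite -CB.
by apply: (fF C); apply: open_nbhs_nbhs; split => //; move: Bs; rewrite -CB.
Qed.

Section WeakStar.
Context {R : realType} (V : normedModType R).

Lemma weak_star_cvg (F : set_system (weak_star V)) (f : weak_star V) :
  Filter F ->
  (forall x, (fun g : weak_star V => (g : dual V) x) @ F --> (f : dual V) x) ->
  F --> f.
Proof.
move=> FF Ff; apply: initial_cvg; apply/cvg_sup => x.
apply: (@initial_cvg _ _ (fun h : V -> R^o => h x)).
exact: Ff.
Qed.

Lemma weak_star_eval (x : V) :
  continuous (fun g : weak_star V => (g : dual V) x : R).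
Proof.
move=> g.
apply: (@continuous_comp (weak_star V) {ptws V -> R^o} R
  (fun f : dual V => (f : {ptws V -> R^o})) (fun h => h x)).
  exact: initial_continuous.
exact: (@proj_continuous V (fun=> R^o) x).
Qed.

End WeakStar.

(** * Extension of functionals and compactness of dual balls *)

Section DualOf.
Context {R : realType} {V : normedModType R}.

Lemma dual_norm_le (f : dual V) (M : R) :
  0 <= M -> (forall x, `|f x| <= M * `|x|) -> `|f| <= M.
Proof.
move=> M0 fM; rewrite dual_normE; apply: opnorm_le => x x1.
by apply: le_trans (fM x) _; rewrite ler_piMr.
Qed.

Lemma dual_of (f : V -> R) (M : R) :
  (forall a x y, f (a *: x + y) = a * f x + f y) ->
  (forall x, `|f x| <= M * `|x|) -> exists g : dual V, forall x, g x = f x.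
Proof.
move=> lf fM.
pose f' : {linear V -> R^o} := HB.pack (f : V -> R^o)
  (GRing.isLinear.Build R V R^o *:%R (f : V -> R^o) lf).
have cf : continuous (f : V -> R^o).
  apply: (@bounded_linear_continuous _ _ _ f'); apply/linear_boundedP.
  near=> N => x.
  have MN : M <= N by near: N; apply: nbhs_pinfty_ge; exact: num_real.
  by apply: le_trans (fM x) _; rewrite ler_wpM2r.
have fP : (f : V -> R^o) \in @functional R V by apply/asboolP; split.
by exists (Dual fP).
Unshelve. all: by end_near. Qed.

End DualOf.

Section HahnBanach.
Context {R : realType} {X : normedModType R}.

(** Partial functionals are encoded as linear graphs in [X * R].  The bound makes
    such a graph single-valued, since it forces [r = 0] when [(0, r)] belongs
    to it; so Zorn's lemma applies to graphs ordered by inclusion, with no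
    domains or gluing of functions to handle. *)
Theorem hahn_banach (G0 : set (X * R)) (M : R) :
  0 <= M -> G0 (0, 0) ->
  (forall a u v, G0 u -> G0 v -> G0 (a *: u.1 + v.1, a * u.2 + v.2)) ->
  (forall u, G0 u -> u.2 <= M * `|u.1|) ->
  exists f : dual X, (forall u, G0 u -> f u.1 = u.2) /\ `|f| <= M.
Proof.
move=> M0 G00 G0lin G0M.
(* [P] speaks of [G0 `|` G] so that it also holds of the union of an empty
   chain. *)
pose P (G : set (X * R)) :=
  [/\ forall a u v, (G0 `|` G) u -> (G0 `|` G) v ->
        (G0 `|` G) (a *: u.1 + v.1, a * u.2 + v.2) &
      forall u, (G0 `|` G) u -> u.2 <= M * `|u.1|].
have [F FP Ftot|G [[lG GM] Gmax]] := @Zorn_bigcup _ P.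
  split.
    move=> a u v Gu Gv.
    have [[E EE]|] : (exists2 E, F E & (G0 `|` E) u /\ (G0 `|` E) v) \/
        (G0 u /\ G0 v).
    - case: Gu => [Gu|[E FE Eu]]; case: Gv => [Gv|[E' FE' Ev]]; first by right.
      + by left; exists E' => //; split; [left|right].
      + by left; exists E => //; split; [right|left].
      + left; have [EE'|EE'] := Ftot _ _ FE FE'.
          by exists E' => //; split; right => //; exact: EE'.
        by exists E => //; split; right => //; exact: EE'.
    - move=> [Eu Ev]; have [lE _] := FP _ EE.
      by case: (lE a u v Eu Ev) => [?|?]; [left|right; exists E].
    - by move=> [? ?]; left; exact: G0lin.
  move=> u [/G0M//|[E FE Eu]].
  by have [_] := FP _ FE; apply; right.
set H := G0 `|` G in lG GM.
have H0 : H (0, 0) by left.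
have HZ a u : H u -> H (a *: u.1, a * u.2).
  by move=> Hu; have := lG a u _ Hu H0; rewrite /= !addr0.
have HM u : H u -> `|u.2| <= M * `|u.1|.
  move=> Hu; rewrite ler_norml GM// andbT lerNl.
  by have := GM _ (HZ (-1) u Hu); rewrite /= scaleN1r mulN1r normrN.
have HB u v : H u -> H v -> H (u.1 - v.1, u.2 - v.2).
  move=> Hu Hv; have := lG (-1) _ _ Hv Hu.
  by rewrite scaleN1r mulN1r [in X in H X -> _]addrC [- _ + u.2]addrC.
have Hfun x r r' : H (x, r) -> H (x, r') -> r = r'.
  move=> Hr Hr'; have := HM _ (HB _ _ Hr Hr').
  by rewrite /= subrr normr0 mulr0 normr_le0 subr_eq0 => /eqP.
have Htot x : exists r, H (x, r).
  apply: contrapT => nH.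
  pose S := [set u.2 - M * `|u.1 - x| | u in H].
  have ubS v : H v -> ubound S (v.2 + M * `|v.1 - x|).
    move=> Hv _ [u Hu <-]; rewrite lerBlDr -addrA -lerBlDl.
    apply: le_trans (ler_norm _) _.
    apply: le_trans (HM _ (HB _ _ Hu Hv)) _; rewrite -mulrDr ler_wpM2l//=.
    by apply: le_trans (ler_distD x _ _) _; rewrite (distrC x) addrC.
  have supS : has_sup S.
    split; first by exists (0 - M * `|0 - x|), (0, 0).
    by exists (0 + M * `|0 - x|); exact: (ubS _ H0).
  pose c := sup S.
  (* Any [c] between the two families of bounds is an admissible value at [x]. *)
  have cP u : H u -> `|u.2 - c| <= M * `|u.1 - x|.
    move=> Hu; rewrite distrC ler_distl; apply/andP; split.
      by apply: ub_le_sup; [case: supS|exists u].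
    by apply: ge_sup; [case: supS|exact: ubS].
  pose G' := [set w : X * R | exists u t, [/\ H u, w.1 = u.1 + t *: x &
    w.2 = u.2 + t * c]].
  have HG' : H `<=` G'.
    by move=> u Hu; exists u, 0; rewrite scale0r mul0r !addr0.
  have G'U : G0 `|` G' = G'.
    by apply/setUidPr => u G0u; apply: HG'; left.
  apply: (Gmax G').
    split; first by move=> u Gu; apply: HG'; right.
    move=> G'G; apply: nH; exists c; right; apply: G'G.
    by exists (0, 0), 1; rewrite scale1r mul1r !add0r.
  rewrite /P G'U; split.
    move=> a _ _ [u [t [Hu -> ->]]] [v [s [Hv -> ->]]].
    exists (a *: u.1 + v.1, a * u.2 + v.2), (a * t + s); split => /=.
    - exact: lG.
    - by rewrite scalerDr scalerDl addrACA scalerA.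
    - by rewrite mulrDr mulrDl addrACA mulrA.
  move=> _ [u [t [Hu -> ->]]].
  have [->|t0] := eqVneq t 0; first by rewrite scale0r mul0r !addr0 GM.
  apply: le_trans (ler_norm _) _.
  have := cP _ (HZ (- t^-1) _ Hu); rewrite /= => /(ler_wpM2l (normr_ge0 (- t))).
  rewrite -normrM mulrCA -normrZ mulrBr scalerBr scalerA !mulrA mulrNN divff//.
  by rewrite scale1r mul1r mulNr scaleNr !opprK.
have [f fP] := choice Htot.
have [g gf] : exists g : dual X, forall x, g x = f x.
  apply: (@dual_of _ _ _ M) => [a x y|x]; last exact: HM (fP x).
  exact: Hfun (fP _) (lG a _ _ (fP x) (fP y)).
exists g; split.
  by move=> [x r] Gr /=; rewrite gf; apply: Hfun (fP x) _; left.
by apply: dual_norm_le => // x; rewrite gf; exact: HM (fP x).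
Qed.

Lemma norming_functional (x : X) :
  exists f : dual X, f x = `|x| /\ `|f| <= 1.
Proof.
pose G0 := [set u : X * R | exists t, u = (t *: x, t * `|x|)].
have [| | | |f [fG f1]] := @hahn_banach G0 1 => //.
- by exists 0; rewrite scale0r mul0r.
- move=> a _ _ [t ->] [s ->]; exists (a * t + s) => /=.
  by rewrite scalerDl mulrDl scalerA mulrA.
- by move=> _ [t ->] /=; rewrite mul1r normrZ ler_wpM2r// ler_norm.
exists f; split => //.
by have /= := fG (x, `|x|); apply; exists 1; rewrite scale1r mul1r.
Qed.

End HahnBanach.

(** * Compactness lemmas *)

Lemma fmap_ultra (T U : Type) (f : T -> U) (F : set_system T) :
  UltraFilter F -> UltraFilter (f @ F).
Proof.
move=> FU; split=> [|G GF sFG]; first exact: fmap_proper_filter.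
apply/seteqP; split => // A GA.
have [//|FnA] := in_ultra_setVsetC (f @^-1` A) FU.
have GI : G (A `&` ~` A) by apply: filterI => //; exact: sFG.
by have [x []] := filter_ex GI.
Qed.

Section Alaoglu.
Context {R : realType} (V : normedModType R).

(** An ultrafilter on the ball converges at each point because the values stay in
    a segment, and the pointwise limit inherits linearity and the bound. *)
Lemma banach_alaoglu (M : R) :
  compact [set f : weak_star V | `|f : dual V| <= M].
Proof.
have [M0|M0] := ltP M 0.
  rewrite (_ : [set _ | _] = set0); first exact: compact0.
  apply/seteqP; split => // f /= fM.
  by have := le_lt_trans (le_trans (normr_ge0 _) fM) M0; rewrite ltxx.
rewrite compact_ultra => F FU FM.
have ev x : exists l : R, (fun g : weak_star V => (g : dual V) x) @ F --> l.
  have := @segment_compact R (- (M * `|x|)) (M * `|x|).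
  rewrite compact_ultra => /(_ ((fun g : weak_star V => (g : dual V) x) @ F)).
  case; first exact: fmap_ultra.
    apply: (@filterS _ F _ _ _ _ FM) => g /= gM; rewrite in_itv /= -ler_norml.
    by apply: le_trans (dual_normP' g x) _; rewrite ler_wpM2r.
  by move=> l [_ Fl]; exists l.
have [l lP] := choice ev.
have lM x : `|l x| <= M * `|x|.
  have h : (fun g : weak_star V => `|(g : dual V) x|) @ F --> `|l x|.
    by apply: cvg_norm; exact: lP.
  rewrite -(cvg_lim _ h)//; apply: limr_le.
    by apply/cvg_ex; eexists; exact: h.
  apply: (@filterS _ F _ _ _ _ FM) => g /= gM.
  by apply: le_trans (dual_normP' g x) _; rewrite ler_wpM2r.
have ll a x y : l (a *: x + y) = a * l x + l y.
  have h : (fun g : weak_star V => (g : dual V) (a *: x + y)) @ F -->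
      a * l x + l y.
    under eq_fun do rewrite linearP.
    by apply: cvgD; [apply: cvgZl_tmp; exact: lP|exact: lP].
  by apply: (cvg_unique _ (lP _) h).
have [f fl] := dual_of ll lM.
exists f; split; first by apply: dual_norm_le => // x; rewrite fl.
by apply: weak_star_cvg => x; rewrite fl; exact: lP.
Qed.

End Alaoglu.

(** * Well-ordered towers of derived sets *)

Section Tower.
Context {T : Type} (B : set T) (der : set T -> set T).

(** The transfinite derivatives of [B] under [der], indexed by themselves in
    place of ordinals.  Intersecting with [B] makes the empty intersection
    harmless. *)
Inductive tower : set T -> Prop :=
| tower_base : tower B
| tower_der L : tower L -> tower (der L)
| tower_cap (F : set (set T)) : (forall L, F L -> tower L) ->
    tower (B `&` \bigcap_(L in F) L).

Hypothesis der_sub : forall L, der L `<=` L.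

Lemma tower_sub_base L : tower L -> L `<=` B.
Proof.
by elim=> [//|{}L _ LB|F _ _ x []//]; apply: subset_trans LB; exact: der_sub.
Qed.

(** Zermelo's argument for the comparability of a tower. *)
Let extreme L := forall M, tower M -> L `<=` M -> L = M \/ L `<=` der M.

Let extreme_cmp L M : tower L -> extreme L -> tower M ->
  L `<=` M \/ M `<=` der L.
Proof.
move=> tL eL; elim=> [|{}M tM IH|F Ft IH].
- by left; exact: tower_sub_base.
- have [LM|ML] := IH; last by right; apply: subset_trans ML; exact: der_sub.
  by have [->|] := eL _ tM LM; [right|left].
- have [[E [FE EL]]|nF] := pselect (exists E, F E /\ E `<=` der L).
    by right; apply: subset_trans EL => x [_]; exact.
  left=> x Lx; split; first exact: tower_sub_base Lx.
  move=> E FE; have [|EL] := IH _ FE; first exact.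
  by case: nF; exists E.
Qed.

Let tower_extreme L : tower L -> extreme L.
Proof.
elim=> [|{}L tL IH|F Ft IH] M tM LM.
- by left; apply/seteqP; split => //; exact: tower_sub_base.
- have [LM'|ML] := extreme_cmp tL IH tM; last first.
    by left; apply/seteqP.
  have [->|LdM] := IH _ tM LM'; first by right.
  by right; apply: subset_trans LdM; exact: der_sub.
- have [[E [FE EM nME]]|nE] := pselect (exists E, [/\ F E, E `<=` M & ~ M `<=` E]).
    right; have [EM'|] := IH _ FE _ tM EM; first by case: nME; rewrite EM'.
    by apply: subset_trans => x [_]; exact.
  left; apply/seteqP; split => // x Mx; split; first exact: tower_sub_base Mx.
  move=> E FE; have [EM|ME] := extreme_cmp (Ft _ FE) (IH _ FE) tM; last first.
    by apply: der_sub; exact: ME.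
  by apply: contrapT => nEx; apply: nE; exists E; split => // /(_ _ Mx).
Qed.

Lemma tower_cmp L M : tower L -> tower M -> L `<=` M \/ M `<=` der L.
Proof. by move=> tL; apply: extreme_cmp => //; exact: tower_extreme. Qed.

Lemma tower_total L M : tower L -> tower M -> L `<=` M \/ M `<=` L.
Proof.
move=> tL tM; have [|ML] := tower_cmp tL tM; [by left|right].
by apply: subset_trans ML _; exact: der_sub.
Qed.

Hypothesis der_lt : forall L, tower L -> L `<=` der L -> L = set0.

(** Well-foundedness: let [L] be the intersection of all members containing those
    of [S].  Were [L] not in [S], comparability would place [der L] above [S]
    too, so that [L] is included in [der L] and hence empty. *)
Lemma tower_max (S : set (set T)) : S !=set0 -> S `<=` tower ->
  exists2 L, S L & forall M, S M -> M `<=` L.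
Proof.
move=> [E0 SE0] St.
pose F : set (set T) := [set M | tower M /\ forall E, S E -> E `<=` M].
pose L := B `&` \bigcap_(M in F) M.
have tL : tower L by apply: tower_cap => M [].
have SL E : S E -> E `<=` L.
  move=> SE x Ex; split; first exact: tower_sub_base (St _ SE) _ Ex.
  by move=> M [_]; apply; [exact: SE|].
have [SL'|nSL] := pselect (S L); first by exists L.
have L0 : L = set0.
  apply: der_lt => // x [_]; apply; split; first exact: tower_der.
  move=> E SE; have [LE|//] := tower_cmp tL (St _ SE).
  by case: nSL; rewrite (_ : L = E)//; apply/seteqP; split => //; exact: SL.
exists E0 => // M SM; suff -> : M = set0 by [].
by apply/seteqP; split => //; rewrite -L0; exact: SL.
Qed.

(** The rank of [C]: the last member of the tower that [C] meets, if there is one. *)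
Definition rank_set (C : set T) : set T :=
  B `&` \bigcap_(M in [set M | tower M /\ M `&` C !=set0]) M.

Lemma tower_rank_set C : tower (rank_set C).
Proof. by apply: tower_cap => M []. Qed.

Lemma rank_set_sub C M : tower M -> M `&` C !=set0 -> rank_set C `<=` M.
Proof. by move=> tM MC x [_]; apply. Qed.

Lemma rank_setS C C' : C `<=` C' -> rank_set C' `<=` rank_set C.
Proof.
move=> CC' x [Bx h]; split => // M [tM [y [My Cy]]]; apply: h; split => //.
by exists y; split => //; exact: CC'.
Qed.

End Tower.

Lemma compact_directed (T : topologicalType) (K : set T) (I : Type) (D : set I)
    (F : I -> set T) :
  compact K -> D !=set0 -> (forall i, D i -> closed (F i)) ->
  (forall i, D i -> K `&` F i !=set0) ->
  (forall i j, D i -> D j -> exists2 k, D k & F k `<=` F i `&` F j) ->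
  exists2 x, K x & forall i, D i -> F i x.
Proof.
move=> cK [i0 Di0] cF KF dF.
pose G : set_system T := filter_from D (fun i => K `&` F i).
have GF : ProperFilter G.
  apply: filter_from_proper; last by move=> i /KF.
  apply: filter_from_filter; first by exists i0.
  move=> i j Di Dj; have [k Dk kij] := dF _ _ Di Dj.
  by exists k => // x [Kx /kij[]].
have [|x [Kx Gx]] := cK G _; first by exists i0 => // x [].
exists x => // i Di; apply: (cF _ Di) => U Ux.
have GFi : G (F i) by exists i => // y [].
exact: Gx GFi Ux.
Qed.

Lemma compact_finite_cover (T : topologicalType) (K : set T) (P : set (set T)) :
  compact K -> (forall x, K x -> exists W, [/\ open W, W x & P W]) ->
  exists2 s : seq (set T), (forall W, W \in s -> P W) &
    forall x, K x -> exists2 W, W \in s & W x.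
Proof.
move=> cK KP; apply: contrapT => nfin.
pose D : set (seq (set T)) := [set s | forall W, W \in s -> open W /\ P W].
have [|s Ds|s Ds|s t Ds Dt|x Kx xP] := @compact_directed T K _ D
    (fun s => [set x | forall W, W \in s -> ~ W x]) cK.
- by exists [::].
- rewrite (_ : [set x | _] = \bigcap_(W in [set` s]) ~` W).
    by apply: closed_bigI => W /Ds[oW _]; exact: open_closedC.
  by apply/seteqP; split=> x xs W /xs.
- apply: contrapT => nK; apply: nfin; exists s => [W /Ds[]//|x Kx].
  apply: contrapT => nx; apply: nK; exists x; split => // W Ws Wx.
  by apply: nx; exists W.
- exists (s ++ t); first by move=> W; rewrite mem_cat => /orP[/Ds|/Dt].
  by move=> x /= xst; split=> W Ws; apply: xst; rewrite mem_cat Ws ?orbT.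
have [W [oW Wx PW]] := KP _ Kx.
have DW : D [:: W] by move=> W'; rewrite inE => /eqP ->.
by have := xP _ DW W; rewrite inE eqxx => /(_ isT).
Qed.

(** * Nets attached to finitely many points of a fragmented space *)

Section Nets.
Context {R : realType} (V : normedModType R).

Implicit Types (L W : set (weak_star V)) (M e : R).

Definition dual_ball (M : R) : set (weak_star V) := [set f : dual V | `|f| <= M].

Lemma closed_eval (x : V) (S : set R) : closed S ->
  closed [set f : weak_star V | S ((f : dual V) x)].
Proof. by move=> cS; apply: closed_comp => // f _; exact: weak_star_eval. Qed.

Lemma closed_dual_ball M : 0 <= M -> closed (dual_ball M).
Proof.
move=> M0; rewrite (_ : dual_ball M =
    \bigcap_x [set f : weak_star V |
      `[- (M * `|x|), M * `|x|]%classic ((f : dual V) x)]).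
  by apply: closed_bigI => x _; apply: closed_eval; exact: itv_closed.
apply/seteqP; split=> f fM => [x _|].
  rewrite /= in_itv /= -ler_norml.
  by apply: le_trans (dual_normP' _ _) _; rewrite ler_wpM2r.
apply: dual_norm_le => // x.
by have := fM x I; rewrite /= in_itv /= -ler_norml.
Qed.

Definition small_piece e L W := forall g h : dual V,
  (W `&` L) g -> (W `&` L) h -> `|g - h| <= e.

Definition fragmented M := forall e L, 0 < e -> L `<=` dual_ball M -> L !=set0 ->
  exists W, [/\ open W, (W `&` L) !=set0 & small_piece e L W].

Definition derived e L := L `\` \bigcup_(W in [set W | open W /\ small_piece e L W]) W.

Definition box (b : seq (V * (rat * rat))) : set (weak_star V) :=
  [set f | forall p, p \in b ->
    ratr p.2.1 <= (f : dual V) p.1 <= ratr p.2.2].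

Lemma closed_box b : closed (box b).
Proof.
rewrite (_ : box b = \bigcap_(p in [set` b]) [set f : weak_star V |
   `[ratr p.2.1, ratr p.2.2]%classic ((f : dual V) p.1)]).
  by apply: closed_bigI => p _; apply: closed_eval; exact: itv_closed.
by apply/seteqP; split=> f /= fb p pb; have := fb p pb; rewrite /= in_itv.
Qed.

Lemma box_cat b c : box (b ++ c) = box b `&` box c.
Proof.
apply/seteqP; split=> f /=.
  by move=> fb; split=> p pb; apply: fb; rewrite mem_cat pb ?orbT.
by move=> [fb fc] p; rewrite mem_cat => /orP[/fb|/fc].
Qed.

Context (M e : R) (M0 : 0 <= M) (e0 : 0 < e) (fragV : fragmented M).

Let tow := tower (dual_ball M) (derived e).
Let rk b := rank_set (dual_ball M) (derived e) (box b).

Let derived_sub L : derived e L `<=` L.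
Proof. exact: subDsetl. Qed.

Let tow_sub L : tow L -> L `<=` dual_ball M.
Proof. exact: tower_sub_base. Qed.

Let derived_lt L : tow L -> L `<=` derived e L -> L = set0.
Proof.
move=> tL Ld; apply/eqP/negPn/negP => /set0P L0.
have [W [oW [f [Wf Lf]] sW]] := fragV e0 (tow_sub tL) L0.
by have [_] := Ld _ Lf; apply; exists W.
Qed.

Let tow_closed L : tow L -> closed L.
Proof.
elim=> [|{}L _ cL|F _ cF]; first exact: closed_dual_ball.
- apply: closedI => //; apply: open_closedC.
  by apply: bigcup_open => W [].
- by apply: closedI; [exact: closed_dual_ball|exact: closed_bigI].
Qed.

Let tow_rk b : tow (rk b).
Proof. exact: tower_rank_set. Qed.

(** Compactness: the box meets the intersection of a chain of closed sets all of
    which it meets. *)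
Let rk_box b : dual_ball M `&` box b !=set0 -> rk b `&` box b !=set0.
Proof.
move=> Bb.
have [|||L|L L'|f Bf fP] := @compact_directed (weak_star V) (dual_ball M) _
    [set L | tow L /\ L `&` box b !=set0] (fun L => L `&` box b).
- exact: banach_alaoglu.
- by exists (dual_ball M); split => //; exact: tower_base.
- by move=> L [tL _]; apply: closedI; [exact: tow_closed|exact: closed_box].
- by move=> [tL [f [Lf bf]]]; exists f; split => //; exact: tow_sub Lf.
- move=> [tL Lb] [tL' Lb'].
  have [LL|LL] := tower_total derived_sub tL tL'.
    by exists L => // f [Lf bf]; split; split => //; exact: LL.
  by exists L' => // f [Lf bf]; split; split => //; exact: LL.
exists f; split; last first.
  by have [] := fP (dual_ball M); [split => //; exact: tower_base|].
by split => // L hL; have [] := fP _ hL.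
Qed.

(** The tower member after [rk b] misses the box, so the small pieces of [rk b]
    cover the compact set [rk b `&` box b]. *)
Lemma box_net b : exists nt : seq (dual V), forall g : dual V,
  rk b g -> box b g -> exists2 z, z \in nt & `|g - z| <= e.
Proof.
have [[f0 [Lf0 bf0]]|Lb] := pselect (rk b `&` box b !=set0); last first.
  by exists [::] => g Lg bg; case: Lb; exists g.
have cL : compact (rk b `&` box b).
  apply: (subclosed_compact _ (@banach_alaoglu R V M)).
    by apply: closedI; [exact: tow_closed|exact: closed_box].
  by move=> f [Lf _]; exact: tow_sub Lf.
have [f [Lf bf]|s sW scov] := compact_finite_cover (P := small_piece e (rk b)) cL.
  apply: contrapT => nf.
  have Ld : rk b `<=` derived e (rk b).
    apply: rank_set_sub; first exact: tower_der (tow_rk b).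
    exists f; split => //; split => // -[W [oW sW] Wf].
    by apply: nf; exists W.
  by have := derived_lt (tow_rk b) Ld; move: Lf0 => /[swap] ->.
exists [seq xget 0 (W `&` rk b) | W <- s] => g Lg bg.
have [W Ws Wg] := scov g (conj Lg bg).
exists (xget 0 (W `&` rk b)); first exact: map_f.
apply: (sW _ Ws); first by split.
by case: xgetP => [y _ //|/(_ g)]; case; split.
Qed.

(** Among the boxes over [A] having [f] in their interior pick [b] with [rk b]
    largest.  Refining [b] can only enlarge its rank, so it leaves [rk b]
    unchanged; hence [rk b] meets every refinement of [box b], and by
    compactness it contains a point of all of them. *)
Lemma box_approx (A : set V) (f : dual V) : `|f| <= M ->
  exists b, (forall p, p \in b -> A p.1) /\
    exists g : dual V, [/\ rk b g, box b g & forall x, A x -> g x = f x].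
Proof.
move=> fM.
pose D := [set b : seq (V * (rat * rat)) | (forall p, p \in b -> A p.1) /\
  forall p, p \in b -> ratr p.2.1 < f p.1 < ratr p.2.2].
have Dcat b c : D b -> D c -> D (b ++ c).
  move=> [bA bf] [cA cf]; split=> p; rewrite mem_cat => /orP[].
  - exact: bA.
  - exact: cA.
  - exact: bf.
  - exact: cf.
have Dbox b : D b -> rk b `&` box b !=set0.
  move=> [_ bf]; apply: rk_box; exists f; split => // p pb.
  by have /andP[/ltW -> /ltW ->] := bf _ pb.
have D0 : D [::] by split.
have [||_ [b Db <-] bmax] := tower_max derived_sub derived_lt (S := rk @` D).
- by exists (rk [::]), [::].
- by move=> _ [b _ <-]; exact: tow_rk.
have rkE c : D c -> rk (b ++ c) = rk b.
  move=> Dc; apply/seteqP; split.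
    by apply: bmax; exists (b ++ c) => //; exact: Dcat.
  by apply: rank_setS; rewrite box_cat; exact: subIsetl.
have [|||c Dc|c c' Dc Dc'|g Lg gP] := @compact_directed (weak_star V) (rk b) _
    D (fun c => box (b ++ c)).
- apply: (subclosed_compact _ (@banach_alaoglu R V M)) => //.
    exact: tow_closed.
  exact: tow_sub.
- by exists [::].
- by move=> c _; exact: closed_box.
- by rewrite -(rkE c)//; apply: Dbox; exact: Dcat.
- exists (c ++ c'); first exact: Dcat.
  by rewrite !box_cat setIACA setIid.
exists b; split; first by case: Db.
exists g; split => //.
  by have := gP _ D0; rewrite cats0.
move=> x Ax; apply/eqP; apply: contraT => gfx.
have d0 : 0 < `|g x - f x| by rewrite normr_gt0 subr_eq0.
have [|q1] := @rat_in_itvoo R (f x - `|g x - f x|) (f x); first by rewrite gtrBl.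
rewrite in_itv /= => /andP[lq1 q1f].
have [|q2] := @rat_in_itvoo R (f x) (f x + `|g x - f x|); first by rewrite ltrDl.
rewrite in_itv /= => /andP[fq2 q2u].
have Dq : D [:: (x, (q1, q2))].
  by split=> p; rewrite inE => /eqP -> //=; rewrite q1f fq2.
have := gP _ Dq; rewrite box_cat => -[_ /(_ (x, (q1, q2)))].
rewrite inE eqxx /= => /(_ isT)/andP[q1g gq2].
suff : `|g x - f x| < `|g x - f x| by rewrite ltxx.
by rewrite {1}ltr_distl (lt_le_trans lq1)//= (le_lt_trans gq2).
Qed.
End Nets.

(** * Countable hulls *)

Lemma countable_range_of_countType (I : countType) (T : Type) (f : I -> T) :
  countable (range f).
Proof. by apply: card_le_trans (card_image_le _ _) _; exact: countableP. Qed.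

Lemma countable_mem_seq (T : eqType) (s : seq T) : countable [set` s].
Proof. exact: finite_set_countable. Qed.

Lemma countable_seqs (T : eqType) (A : set T) :
  countable A -> countable [set s : seq T | forall x, x \in s -> A x].
Proof.
move=> /countable_injP[f fi]; apply/countable_injP.
exists (fun s => pickle (map f s)) => s t; rewrite !inE /= => sA tA.
move=> /(pcan_inj pickleK); elim: s t sA tA => [|x s IH] [|y t]//= sA tA [fxy st].
have Ax : A x by apply: sA; rewrite mem_head.
have Ay : A y by apply: tA; rewrite mem_head.
rewrite (fi x y) ?inE// (IH t)// => z zs; [apply: sA|apply: tA];
  by rewrite inE zs orbT.
Qed.

Section CountableHull.
Context {T : Type} (Psi : set T -> set T).

(** Operators whose stable countable sets are cofinal and closed under increasing
    unions of sequences. *)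
Record finitary := {
  finitary_countable : forall A, countable A -> countable (Psi A);
  finitary_mono : forall A B, A `<=` B -> Psi A `<=` Psi B;
  finitary_bigcup : forall A : nat -> set T,
    (forall n, A n `<=` A n.+1) -> Psi (\bigcup_n A n) `<=` \bigcup_n Psi (A n) }.

Lemma countable_hull (A : set T) : finitary -> countable A ->
  exists B, [/\ countable B, A `<=` B & Psi B `<=` B].
Proof.
move=> fPsi cA; pose H := fix H n := if n is m.+1 then H m `|` Psi (H m) else A.
exists (\bigcup_n H n); split.
- apply: bigcup_countable => // n _; elim: n => //= n IH.
  rewrite -bigcup2E; apply: bigcup_countable => // -[|[|k]] _ //=.
  exact: finitary_countable.
- by move=> x Ax; exists 0%N.
- move=> x /(finitary_bigcup fPsi)[|n _ xn]; first by move=> n y ?; left.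
  by exists n.+1 => //; right.
Qed.

End CountableHull.

Lemma chain_le (T : Type) (A : nat -> set T) :
  (forall n, A n `<=` A n.+1) -> forall m n, (m <= n)%N -> A m `<=` A n.
Proof.
move=> An m n /subnK <-; elim: (n - m)%N => // k IH.
by apply: subset_trans IH _; rewrite addSn; exact: An.
Qed.

Lemma exists_invS_le (R : realType) (e : R) :
  0 < e -> exists k : nat, k.+1%:R^-1 <= e.
Proof.
move=> e0; exists (Num.bound e^-1); rewrite invf_ple ?posrE//.
apply: ltW; apply: lt_trans (archi_boundP _) _; rewrite ?invr_ge0 ?ltW//.
by rewrite ltr_nat.
Qed.

(** The nets of all boxes at the points of [s], for all radii [m] and all
    tolerances [1 / (k + 1)].  The set [A] is arbitrary because the choice
    [A = setT] is what makes the ranges of the projections cover the dual. *)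
Lemma dual_nets (R : realType) (V : normedModType R) :
  (forall M, 0 <= M -> fragmented V M) ->
  exists nt : seq V -> set (dual V), (forall s, countable (nt s)) /\
    forall (A : set V) (f : dual V) e, 0 < e ->
      exists s, (forall x, x \in s -> A x) /\
        exists2 z, nt s z & forall x, A x -> `|z x - f x| <= e * `|x|.
Proof.
move=> fragV.
have eP k : 0 < k.+1%:R^-1 :> R by [].
have [F FP] := choice (fun mkb : nat * nat * seq (V * (rat * rat)) =>
  box_net (ler0n R mkb.1.1) (eP mkb.1.2) (fragV _ (ler0n R mkb.1.1)) mkb.2).
exists (fun s => \bigcup_(c in [set: nat * nat * seq (rat * rat)])
  [set` F (c.1.1, c.1.2, zip s c.2)]); split.
  move=> s; apply: bigcup_countable => [|c _]; first exact: countableP.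
  exact: countable_mem_seq.
move=> A f e e0.
have [m fm] : exists m : nat, `|f| <= m%:R.
  by exists (Num.bound `|f|); apply/ltW/archi_boundP.
have [k ke] := exists_invS_le e0.
have [b [bA [g [rg bg gf]]]] :=
  box_approx (ler0n R m) (eP k) (fragV _ (ler0n R m)) A fm.
have [z zF gz] := FP (m, k, b) _ rg bg.
exists (unzip1 b); split; first by move=> x /mapP[p pb ->]; exact: bA.
exists z; first by exists (m, k, unzip2 b) => //=; rewrite zip_unzip.
move=> x Ax; rewrite -gf// distrC (_ : g x - z x = (g - z) x)//.
apply: le_trans (dual_normP' _ _) _; rewrite ler_wpM2r//.
exact: le_trans gz ke.
Qed.

(** * The projections *)

Lemma closure_transfer (T U : topologicalType) (D : set T) (S : set U)
    (f : T -> U) : closed S -> continuous f -> (forall x, D x -> S (f x)) ->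
  forall x, closure D x -> S (f x).
Proof.
move=> cS cf Df x Dx; have : closure [set x | S (f x)] x.
  exact: closure_subset Dx.
by rewrite -(proj1 (closure_id _))//; apply: closed_comp cS => y _; exact: cf.
Qed.

Lemma closure_ratr (R : realType) (a : R) : closure (range (@ratr R)) a.
Proof.
move=> W; rewrite nbhsE => -[W' [oW Wa] WW].
have [|b [Wb [q _ qb]]] := @dense_rat R W' _ oW; first by exists a.
by exists b; split; [exists q|exact: WW].
Qed.

Section Skeleton.
Context {R : realType} (V : normedModType R) (nt : seq V -> set (dual V)).
Hypothesis nt_countable : forall s, countable (nt s).
Hypothesis nt_approx : forall (A : set V) (f : dual V) e, 0 < e ->
  exists s, (forall x, x \in s -> A x) /\
    exists2 z, nt s z & forall x, A x -> `|z x - f x| <= e * `|x|.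

Definition net_over (A : set V) : set (dual V) :=
  \bigcup_(s in [set s : seq V | forall x, x \in s -> A x]) nt s.

Lemma net_over_countable A : countable A -> countable (net_over A).
Proof. by move=> cA; apply: bigcup_countable => //; exact: countable_seqs. Qed.

Lemma net_over_mono A B : A `<=` B -> net_over A `<=` net_over B.
Proof. by move=> AB z [s sA sz]; exists s => //= x /sA/AB. Qed.

Lemma net_over_bigcup (A : nat -> set V) : (forall n, A n `<=` A n.+1) ->
  net_over (\bigcup_n A n) `<=` \bigcup_n net_over (A n).
Proof.
move=> An z [s sA sz].
suff [n sn] : exists n, forall x, x \in s -> A n x by exists n => //; exists s.
elim: s sA {sz} => [|x s IH] sA; first by exists 0%N.
have [m _ mx] : (\bigcup_n A n) x by apply: sA; rewrite mem_head.
have [|n sn] := IH; first by move=> y ys; apply: sA; rewrite inE ys orbT.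
exists (maxn m n) => y; rewrite inE => /orP[/eqP ->|ys].
  exact: (chain_le An (leq_maxl m n)).
by apply: (chain_le An (leq_maxr m n)); exact: sn.
Qed.

Lemma almost_norming : exists nu : dual V -> nat -> V, forall z k,
  `|nu z k| <= 1 /\ `|z| - k.+1%:R^-1 < `|z (nu z k)|.
Proof.
suff h (z : dual V) : exists x : nat -> V, forall k,
    `|x k| <= 1 /\ `|z| - k.+1%:R^-1 < `|z (x k)|.
  by have [nu nuP] := choice h; exists nu.
suff hk k : exists x, `|x| <= 1 /\ `|z| - k.+1%:R^-1 < `|z x|.
  by have [x xP] := choice hk; exists x.
have := @sup_adherent R _ k.+1%:R^-1 _ (opnorm_has_sup (@dual_continuous R V z)).
by case=> // _ [x /= x1 <-] zx; exists x.
Qed.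

Definition norms (A : set V) (z : dual V) := forall c, 0 <= c ->
  (forall x, A x -> `|z x| <= c * `|x|) -> `|z| <= c.

Lemma closed_norms A : closed [set z : dual V | norms A z].
Proof.
move=> z clz c c0 zA; apply/ler_addgt0Pr => e e0.
have e20 : 0 < e / 2 by rewrite divr_gt0.
have [z' [nz']] := clz _ (nbhsx_ballx z _ e20).
rewrite -ball_normE /= => zz'.
have : `|z'| <= c + e / 2.
  apply: nz' => [|x Ax]; first by rewrite addr_ge0 // ltW.
  rewrite -(subrK (z x) (z' x)) (le_trans (ler_normD _ _))// addrC mulrDl lerD//.
    exact: zA.
  rewrite distrC (_ : z x - z' x = (z - z') x)// (le_trans (dual_normP' _ _))//.
  by rewrite ler_wpM2r// ltW.
move=> z'c; rewrite -(subrK z' z) (le_trans (ler_normD _ _))// [e]splitr.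
by rewrite addrA [leRHS]addrC lerD// ltW.
Qed.

Variable nu : dual V -> nat -> V.
Hypothesis nuP : forall z k,
  `|nu z k| <= 1 /\ `|z| - k.+1%:R^-1 < `|z (nu z k)|.

(** Three terms suffice: a norm computed on [A] for such combinations gives at
    once the injectivity, the isometry and the linearity of the lifting from
    restrictions to [A] back to functionals. *)
Definition comb (c : rat) (y : dual V * dual V * dual V) : dual V :=
  ratr c *: y.1.1 + y.1.2 - y.2.

Definition norming_points (A : set V) : set V :=
  \bigcup_(y in net_over A `*` net_over A `*` net_over A)
    range (fun ck : rat * nat => nu (comb ck.1 y) ck.2).

Lemma norming_points_finitary : finitary norming_points.
Proof.
split=> [A cA|A B AB|A An].
- apply: bigcup_countable => [|y _]; last exact: countable_range_of_countType.
  by do 2?apply: countableX; exact: net_over_countable.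
- move=> x [y [[Ay1 Ay2] Ay3] yx]; exists y => //.
  by split; [split|]; exact: net_over_mono AB _ _.
- move=> x [y [[]]].
  move=> /(net_over_bigcup An)[i _ yi] /(net_over_bigcup An)[j _ yj].
  move=> /(net_over_bigcup An)[k _ yk].
  move=> yx; exists (maxn (maxn i j) k) => //; exists y => //; split; [split|].
  + by apply: net_over_mono yi; apply: chain_le => //; rewrite -maxnA leq_maxl.
  + by apply: net_over_mono yj; apply: chain_le => //; rewrite (maxnC i) -maxnA leq_maxl.
  + by apply: net_over_mono yk; apply: chain_le => //; rewrite leq_maxr.
Qed.

Section OneIndex.
Context (A : set V) (closedA : norming_points A `<=` A).

Lemma norms_rat_comb c (y1 y2 y3 : dual V) : 
  net_over A y1 -> net_over A y2 -> net_over A y3 -> norms A (ratr c *: y1 + y2 - y3).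
Proof.
move=> Ay1 Ay2 Ay3 M M0 zM; apply/ler_addgt0Pr => e e0.
set z := _ - y3 in zM *.
have [k ke] := exists_invS_le e0.
have [n1 zn] := nuP z k.
have An : A (nu z k).
  by apply: closedA; exists (y1, y2, y3) => //; exists (c, k).
rewrite -lerBlDr; apply: le_trans (lerB (lexx _) ke) _.
apply/ltW/(lt_le_trans zn); apply: le_trans (zM _ An) _.
by rewrite ler_piMr.
Qed.

(** One passes from rational combinations of net functionals to real combinations
    of their limits one variable at a time, the norming condition being
    closed. *)
Lemma norms_comb (a : R) (y1 y2 y3 : dual V) :
  closure (net_over A) y1 -> closure (net_over A) y2 -> closure (net_over A) y3 ->
  norms A (a *: y1 + y2 - y3).
Proof.
have ind T D f := @closure_transfer T _ D _ f (@closed_norms A).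
move=> Y1 Y2 Y3.
have Ra := @closure_ratr R a.
apply: (ind R _ (fun a : R => a *: y1 + y2 - y3) _ _ _ Ra) => [b|_ [c _ <-]].
  rewrite /continuous_at.
  apply: (@cvgB _ _ _ (nbhs b)); last exact: cvg_cst.
  apply: (@cvgD _ _ _ (nbhs b)); last exact: cvg_cst.
  by apply: cvgZr_tmp; exact: cvg_id.
apply: (ind (dual V) _ (fun y1 : dual V => ratr c *: y1 + y2 - y3) _ _ _ Y1) => [b|{Y1}{}y1 Y1].
  rewrite /continuous_at.
  apply: (@cvgB _ _ _ (nbhs b)); last exact: cvg_cst.
  apply: (@cvgD _ _ _ (nbhs b)); last exact: cvg_cst.
  by apply: cvgZl_tmp; exact: cvg_id.
apply: (ind (dual V) _ (fun y2 : dual V => ratr c *: y1 + y2 - y3) _ _ _ Y2) => [b|{Y2}{}y2 Y2].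
  rewrite /continuous_at.
  apply: (@cvgB _ _ _ (nbhs b)); last exact: cvg_cst.
  by apply: (@cvgD _ _ _ (nbhs b)); [exact: cvg_cst|exact: cvg_id].
apply: (ind (dual V) _ (fun y3 : dual V => ratr c *: y1 + y2 - y3) _ _ _ Y3) => [b|{Y3}{}y3 Y3].
  by rewrite /continuous_at; apply: (@cvgB _ _ _ (nbhs b)); [exact: cvg_cst|exact: cvg_id].
exact: norms_rat_comb.
Qed.

Lemma norms_net_closure (y : dual V) : closure (net_over A) y -> norms A y.
Proof.
move=> Y; have := @norms_comb 1 _ _ _ Y Y Y.
by rewrite scale1r addrK.
Qed.

Lemma restriction_inj (y z : dual V) : closure (net_over A) y -> closure (net_over A) z ->
  (forall x, A x -> y x = z x) -> y = z.
Proof.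
move=> Y Z yz; apply/eqP; rewrite -subr_eq0 -normr_le0.
have := @norms_comb 0 _ _ _ Y Y Z; rewrite scale0r add0r; apply=> // x Ax.
by rewrite mul0r (_ : (y - z) x = y x - z x)// yz// subrr normr0.
Qed.

(** Net functionals approximating [f] on [A] form a Cauchy sequence, because
    their mutual distances can be computed on [A]. *)
Lemma restriction_surj (f : dual V) :
  exists2 y, closure (net_over A) y & forall x, A x -> y x = f x.
Proof.
have [z zP] : exists z : nat -> dual V, forall k,
    net_over A (z k) /\ forall x, A x -> `|z k x - f x| <= k.+1%:R^-1 * `|x|.
  suff hk k : exists z, net_over A z /\
      forall x, A x -> `|z x - f x| <= k.+1%:R^-1 * `|x|.
    by have [z zP] := choice hk; exists z.
  have [|s [sA [z sz zf]]] := @nt_approx A f k.+1%:R^-1 => //.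
  by exists z; split => //; exists s.
have zd k j : `|z k - z j| <= k.+1%:R^-1 + j.+1%:R^-1.
  have := @norms_comb 0 _ _ _ (subset_closure (zP k).1) (subset_closure (zP k).1)
    (subset_closure (zP j).1); rewrite scale0r add0r; apply=> [|x Ax].
    by rewrite addr_ge0.
  rewrite (_ : (z k - z j) x = (z k x - f x) - (z j x - f x)); last first.
    by rewrite opprB addrA subrK.
  by rewrite mulrDl (le_trans (ler_normB _ _))// lerD// (zP _).2.
have cz : cvg (z @ \oo).
  apply: cauchy_cvg; apply: cauchy_exP => e e0.
  have e20 : 0 < e / 2 by rewrite divr_gt0.
  have [k ke] := exists_invS_le e20; exists (z k.+1), k.+1 => // j /= kj.
  rewrite -ball_normE /=; apply: le_lt_trans (zd _ _) _; rewrite [e]splitr.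
  apply: ltr_leD; last by apply: le_trans ke; rewrite lef_pV2 ?posrE// ler_nat ltnW.
  by apply: lt_le_trans ke; rewrite ltf_pV2 ?posrE// ltr_nat.
exists (lim (z @ \oo)).
  move=> U /cz[n _ nU]; exists (z n); split; first exact: (zP n).1.
  by apply: nU => /=.
move=> x Ax.
have scaled_le e : 0 < e -> 0 < e / (`|x| + 1) /\ e / (`|x| + 1) * `|x| <= e.
  move=> e0; have x0 : 0 < `|x| + 1 by rewrite ltr_wpDl.
  by rewrite divr_gt0// mulrAC ler_pdivrMr// ler_wpM2l ?(ltW e0)// lerDl.
have h1 : (fun k => z k x : R) @ \oo --> (lim (z @ \oo) : dual V) x.
  apply/cvgrPdist_le => e /scaled_le[d0 de].
  move/cvgrPdist_le : (cz) => /(_ _ d0); apply: filterS => k ke.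
  rewrite (_ : _ - _ = (lim (z @ \oo) - z k) x)// (le_trans (dual_normP' _ _))//.
  exact: le_trans (ler_wpM2r (normr_ge0 _) ke) de.
have h2 : (fun k => z k x : R) @ \oo --> f x.
  apply/cvgrPdist_le => e /scaled_le[d0 de].
  have [k ke] := exists_invS_le d0; exists k => // j /= kj.
  rewrite distrC (le_trans ((zP j).2 _ Ax))//.
  apply: le_trans de; rewrite ler_wpM2r// (le_trans _ ke)//.
  by rewrite lef_pV2 ?posrE// ler_nat.
exact: (cvg_unique _ h1 h2).
Qed.
End OneIndex.
End Skeleton.

(** * The index set and the projectional skeleton *)

Section Index.
Context {T : choiceType} (Psi : set T -> set T).

Definition stable : Type := {A : set T | `[< countable A /\ Psi A `<=` A >]}.
HB.instance Definition _ := Choice.on stable.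

Definition carrier (A : stable) : set T := sval A.

Definition stable_le (A B : stable) := `[< carrier A `<=` carrier B >].

Let stable_le_refl : reflexive stable_le.
Proof. by move=> A; apply/asboolP. Qed.

Let stable_le_anti : antisymmetric stable_le.
Proof.
move=> A B /andP[/asboolP AB /asboolP BA]; apply: val_inj.
by apply/seteqP.
Qed.

Let stable_le_trans : transitive stable_le.
Proof.
by move=> B A C /asboolP AB /asboolP BC; apply/asboolP; exact: subset_trans BC.
Qed.

HB.instance Definition _ := Order.Le_isPOrder.Build (Order.Disp tt tt) stable
  stable_le_refl stable_le_anti stable_le_trans.

Lemma stableE (A B : stable) : (A <= B)%O <-> carrier A `<=` carrier B.
Proof. by split=> [/asboolP|AB]//; apply/asboolP. Qed.

Lemma stable_countable (A : stable) : countable (carrier A).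
Proof. by case: A => A /= /asboolP[]. Qed.

Lemma stable_closed (A : stable) : Psi (carrier A) `<=` carrier A.
Proof. by case: A => A /= /asboolP[]. Qed.

Lemma stable_of (A : set T) : countable A -> Psi A `<=` A ->
  exists t : stable, carrier t = A.
Proof.
move=> cA PA; have AP : `[< countable A /\ Psi A `<=` A >] by apply/asboolP.
by exists (exist _ A AP).
Qed.

Hypothesis fPsi : finitary Psi.

Lemma stable_hull (A : set T) : countable A -> exists B : stable, A `<=` carrier B.
Proof.
move=> cA; have [B [cB AB PB]] := countable_hull fPsi cA.
by have [t tB] := stable_of cB PB; exists t; rewrite tB.
Qed.

Lemma stable_directed : up_directed stable.
Proof.
split; first by have [B _] := @stable_hull set0 (countable0 _); exists.
move=> A B.
have [|C ABC] := @stable_hull (carrier A `|` carrier B).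
  rewrite -bigcup2E; apply: bigcup_countable => // -[|[|k]] _ //=;
    exact: stable_countable.
by exists C; split; apply/stableE => x ?; apply: ABC; [left|right].
Qed.

Lemma stable_bigcup (u : nat -> stable) : nondecreasing_seq u ->
  exists2 t : stable, carrier t = \bigcup_n carrier (u n) & supremums (range u) t.
Proof.
move=> u_nd.
have [||t tE] := @stable_of (\bigcup_n carrier (u n)).
- by apply: bigcup_countable => // n _; exact: stable_countable.
- move=> x /(finitary_bigcup fPsi)[n|n _ xn].
    exact/stableE/u_nd/leqnSn.
  by exists n => //; exact: stable_closed xn.
exists t => //; split=> [_ [n _ <-]|A Aub]; apply/stableE => x; rewrite tE.
  by exists n.
by move=> [n _ xn]; have /stableE := Aub (u n) (imageT _ _); apply.
Qed.

Lemma stable_sigma_complete : sigma_complete stable.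
Proof. by move=> u /stable_bigcup[t _ ut]; exists t. Qed.

Lemma stable_sup (u : nat -> stable) t : nondecreasing_seq u ->
  supremums (range u) t -> carrier t = \bigcup_n carrier (u n).
Proof.
move=> /stable_bigcup[s <- [us sl]] [ut tl].
suff -> : t = s by [].
by apply: le_anti; rewrite tl// sl.
Qed.

End Index.

Section SkeletonTheorem.
Context {R : realType} (V : normedModType R).

(** [p A f] is the only member of [Y A] that agrees with [f] on [A]; each clause
    of the definition of a skeleton is read off from this uniqueness. *)
Theorem fragmented_skeleton : (forall M, 0 <= M -> fragmented V M) ->
  has_projectional_skeleton (dual V) 1.
Proof.
move=> /dual_nets[nt [nt_countable nt_approx]].
have [nu nuP] := @almost_norming R V.
have fPsi := norming_points_finitary nt_countable nu.
pose Psi := norming_points nt nu.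
have [p pP] : exists p : stable Psi -> dual V -> dual V, forall A f,
    closure (net_over nt (carrier A)) (p A f) /\ forall x, carrier A x -> p A f x = f x.
  have h (A : stable Psi) (f : dual V) : exists y : dual V,
      closure (net_over nt (carrier A)) y /\ forall x, carrier A x -> y x = f x.
    have [y yA yf] := restriction_surj nt_approx nuP (@stable_closed _ Psi A) f.
    by exists y.
  have h' (A : stable Psi) : exists q : dual V -> dual V, forall f,
      closure (net_over nt (carrier A)) (q f) /\ forall x, carrier A x -> q f x = f x.
    by have [q qP] := choice (h A); exists q.
  by have [p pP] := choice h'; exists p.
pose Y (A : stable Psi) := closure (net_over nt (carrier A)).
have p_uniq (A : stable Psi) (f y : dual V) : Y A y ->
    (forall x, carrier A x -> y x = f x) -> p A f = y.
  move=> YAy yf; apply: (restriction_inj nuP (@stable_closed _ Psi A)) => //.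
    exact: (pP A f).1.
  by move=> x Ax; rewrite (pP A f).2// yf.
have p_id (A : stable Psi) (y : dual V) : Y A y -> p A y = y by move=> Yy; apply: p_uniq.
have p_norm (A : stable Psi) (f : dual V) : `|p A f| <= `|f|.
  apply: (norms_net_closure nuP (@stable_closed _ Psi A) (pP A f).1) => // x Ax.
  by rewrite (pP A f).2// dual_normP'.
have p_lin (A : stable Psi) : linear (p A).
  move=> a f g; apply/eqP; rewrite -subr_eq0 -normr_le0 -normrN opprB.
  have := @norms_comb _ _ nt nu nuP _ (@stable_closed _ Psi A) a _ _ _
    (pP A f).1 (pP A g).1 (pP A (a *: f + g)).1.
  apply=> // x Ax; rewrite mul0r.
  rewrite (_ : (_ - _ : dual V) x = a * p A f x + p A g x - p A (a *: f + g) x)//.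
  by rewrite !(pP A _).2// (_ : (a *: f + g : dual V) x = a * f x + g x)// subrr normr0.
have p_range (A : stable Psi) : range (p A) = Y A.
  apply/seteqP; split=> [_ [f _ <-]|y Yy]; first exact: (pP A f).1.
  by exists y => //; exact: p_id.
have Y_mono (A B : stable Psi) : (A <= B)%O -> Y A `<=` Y B.
  by move=> /stableE AB; apply: closure_subset; exact: net_over_mono.
pose P (A : stable Psi) : {linear dual V -> dual V} :=
  HB.pack (p A) (GRing.isLinear.Build R (dual V) (dual V) *:%R (p A) (p_lin A)).
exists (Order.Disp tt tt), (stable Psi), P; split; last first.
  by move=> A; apply: opnorm_le => f f1; exact: le_trans (p_norm A f) f1.
split.
- exact: stable_directed.
- exact: stable_sigma_complete.
- move=> A; apply: bounded_linear_continuous; apply/linear_boundedP.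
  near=> M => f /=.
  have M1 : 1 <= M by near: M; apply: nbhs_pinfty_ge; exact: num_real.
  by apply: le_trans (p_norm A f) _; rewrite ler_peMl.
- by move=> A; apply/funext => f /=; rewrite p_id//; exact: (pP A f).1.
- move=> A; rewrite /P /= p_range; exists (net_over nt (carrier A)); split => //.
    by apply: net_over_countable => //; exact: stable_countable.
  exact: subset_closure.
- apply/seteqP; split => // f _.
  have h k : exists s : seq V, exists2 z, nt s z & `|z - f| <= k.+1%:R^-1.
    have [|s [_ [z sz zf]]] := nt_approx setT f k.+1%:R^-1; first by [].
    by exists s, z => //; apply: dual_norm_le => // x; exact: zf.
  have [s sP] := choice h.
  have [|A sA] := @stable_hull _ _ fPsi (\bigcup_k [set` s k]).
    by apply: bigcup_countable => // k _; exact: countable_mem_seq.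
  exists A => //; exists f => //=; apply: p_id => U.
  rewrite -nbhs_ballE => -[e /= e0 eU].
  have [k ke] := exists_invS_le (divr_gt0 e0 (ltr0Sn R 1)).
  have [z sz zf] := sP k; exists z; split.
    by exists (s k) => // x xs; apply: sA; exists k.
  apply: eU; rewrite -ball_normE /= distrC (le_lt_trans zf)// (le_lt_trans ke)//.
  by rewrite ltr_pdivrMr// ltr_pMr// ltr1n.
- move=> A B AB; split; apply/funext => f /=; last first.
    by rewrite [RHS]p_id//; exact: (Y_mono _ _ AB _ (pP A f).1).
  apply: p_uniq; first exact: (pP A _).1.
  move=> x Ax; rewrite (pP A _).2// (pP B _).2//.
  by move/stableE : AB; apply.
- move=> u t u_inc ut; rewrite /P /= p_range /Y.
  have u_nd : nondecreasing_seq u by move=> m n; rewrite u_inc.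
  rewrite (stable_sup fPsi u_nd ut); apply/seteqP; split.
    apply: closure_subset => z /net_over_bigcup[n|n _ nz]; first exact/stableE/u_nd/leqnSn.
    by exists n => //; rewrite p_range; exact: subset_closure.
  rewrite closureE => z; apply; split; first exact: closed_closure.
  move=> y [n _]; rewrite p_range; apply: closure_subset; apply: net_over_mono => x.
  by exists n.
Unshelve. all: by end_near. Qed.
End SkeletonTheorem.

(** * Asplund spaces are fragmented *)

Lemma no_countable_cantor (T : Type) (D : set T) (d : (nat -> bool) -> T) :
  countable D -> (forall s, D (d s)) -> injective d -> False.
Proof.
move=> /countable_injP[h hD] Dd d_inj.
pose s n := ~~ `[< exists t, h (d t) = n /\ t n >].
have := erefl (s (h (d s))).
rewrite {1}/s; case: asboolP => [[t [hst st]]|ns].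
  have ts : t = s by apply/d_inj/hD => //; rewrite inE.
  by move: st; rewrite ts => ->.
by move=> /esym ss; apply: ns; exists s.
Qed.

Section RationalSpan.
Context {R : realType} {X : normedModType R}.

Let rat_combos (A : set X) : set X :=
  \bigcup_(u in A `*` A) range (fun q : rat => ratr q *: u.1 + u.2).

Let rat_combos_finitary : finitary rat_combos.
Proof.
split=> [A cA|A B AB|A An].
- apply: bigcup_countable => [|y _]; last exact: countable_range_of_countType.
  exact: countableX.
- by move=> x [u [Au1 Au2] ux]; exists u => //; split; exact: AB.
- move=> x [u [[i _ iu] [j _ ju]] ux]; exists (maxn i j) => //; exists u => //.
  split; first exact: (chain_le An (leq_maxl i j)).
  exact: (chain_le An (leq_maxr i j)).
Qed.

Lemma closed_separable_span (S : set X) : countable S ->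
  exists U : submodClosed X,
    [/\ closed [set` U], separable [set` U] & forall x, S x -> x \in U].
Proof.
move=> cS.
have [|E [cE SE PE]] :=
    @countable_hull _ rat_combos (S `|` [set 0]) rat_combos_finitary.
  by rewrite -bigcup2E; apply: bigcup_countable => // -[|[|k]] _ //=; exact: countable1.
have E0 : E 0 by apply: SE; right.
have Elin q u v : E u -> E v -> E (ratr q *: u + v).
  by move=> Eu Ev; apply: PE; exists (u, v) => //; exists q.
have ind T D f := @closure_transfer T _ D _ f (@closed_closure _ E).
pose U0 : {pred X} := fun x => `[< closure E x >].
have U0P : submod_closed U0.
  split; first by apply/asboolP; exact: subset_closure.
  move=> a u v /asboolP Eu /asboolP Ev; apply/asboolP.
  have Ra := @closure_ratr R a.
  apply: (ind R _ (fun a : R => a *: u + v) _ _ _ Ra) => [b|_ [q _ <-]].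
    rewrite /continuous_at; apply: (@cvgD _ _ _ (nbhs b)); last exact: cvg_cst.
    by apply: cvgZr_tmp; exact: cvg_id.
  apply: (ind X _ (fun u : X => ratr q *: u + v) _ _ _ Eu) => [b|{Eu}{}u Eu].
    rewrite /continuous_at; apply: (@cvgD _ _ _ (nbhs b)); last exact: cvg_cst.
    by apply: cvgZl_tmp; exact: cvg_id.
  apply: (ind X _ (fun v : X => ratr q *: u + v) _ _ _ Ev) => [b|{Ev}{}v Ev].
    by rewrite /continuous_at; apply: (@cvgD _ _ _ (nbhs b)); [exact: cvg_cst|exact: cvg_id].
  by apply: subset_closure; exact: Elin.
pose U : submodClosed X := HB.pack U0 (GRing.isSubmodClosed.Build R X U0 U0P).
have UE : [set` U] = closure E.
  by apply/seteqP; split=> x /=; [move/asboolP|move=> ?; apply/asboolP].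
exists U; rewrite UE; split.
- exact: closed_closure.
- by exists E; split => //; exact: subset_closure.
- by move=> x Sx; apply/asboolP; apply: subset_closure; apply: SE; left.
Qed.

End RationalSpan.

Section CantorTree.
Context {R : realType} (V : normedModType R) (M : R).

(** If every piece of [L] contains two functionals more than [e] apart, then a
    vector of the unit ball and a threshold split it into two open pieces
    separated by [e] at that vector. *)
Lemma cantor_tree : 0 <= M -> ~ fragmented V M ->
  exists (e : R) (x : seq bool -> V) (f : (nat -> bool) -> dual V),
    [/\ 0 < e, forall s, `|x s| <= 1 &
      forall s t, s <> t -> exists p, e <= `|f s (x p) - f t (x p)|].
Proof.
move=> M0 /existsNP[e /existsNP[L /not_implyP[e0 /not_implyP[LM /not_implyP[L0 nL]]]]].
have [xc xcP] : exists xc : set (weak_star V) -> V * R, forall W, open W ->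
    (W `&` L) !=set0 -> `|(xc W).1| <= 1 /\ exists g h : dual V,
      [/\ (W `&` L) g, (W `&` L) h, h (xc W).1 < (xc W).2 &
         (xc W).2 + e < g (xc W).1].
  suff h W : exists xc : V * R, open W ->
      (W `&` L) !=set0 -> `|xc.1| <= 1 /\ exists g h : dual V,
      [/\ (W `&` L) g, (W `&` L) h, h xc.1 < xc.2 & xc.2 + e < g xc.1].
    by have [xc xcP] := choice h; exists xc.
  have [[oW WL]|nW] := pselect (open W /\ (W `&` L) !=set0); last first.
    by exists (0, 0) => oW WL; case: nW.
  have /existsNP[g /existsNP[h /not_implyP[Wg /not_implyP[Wh /negP]]]] :
    ~ small_piece e L W by move=> sW; apply: nL; exists W.
  rewrite -ltNge => egh.
  have [x [x1 ex]] : exists x, `|x| <= 1 /\ e < g x - h x.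
    have [_ [x /= x1 <-] ex] := sup_gt (opnorm_has_sup (@dual_continuous R V (g - h))).1 egh.
    have [gh0|gh0] := leP 0 (g x - h x).
      by exists x; split => //; rewrite -(ger0_norm gh0).
    exists (- x); rewrite normrN; split => //.
    by rewrite !linearN /= -opprD -(ltr0_norm gh0).
  (* The slack [g x - h x - e] is shared between the two strict inequalities. *)
  exists (x, h x + (g x - h x - e) / 2) => _ _; split => //=.
  have d0 : 0 < (g x - h x - e) / 2 by rewrite divr_gt0// subr_gt0.
  exists g, h; split => //; first by rewrite ltrDl.
  rewrite -ltrBrDr -ltrBrDl -[ltRHS]addrA [- e + _]addrC addrA.
  by rewrite ltr_pdivrMr// ltr_pMr ?ltr1n// subr_gt0.
(* The last choice made stands at the head of the word. *)
pose U := fix U (s : seq bool) : set (weak_star V) := if s is b :: s' then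
  U s' `&` [set f : weak_star V |
    if b then (xc (U s')).2 + e < (f : dual V) (xc (U s')).1
    else (f : dual V) (xc (U s')).1 < (xc (U s')).2] else setT.
have UP s : open (U s) /\ (U s `&` L) !=set0.
  elim: s => [|b s [oU UL]]; first by split; [exact: openT|rewrite setTI].
  have [_ [g [h [[Ug Lg] [Uh Lh] hc cg]]]] := xcP _ oU UL.
  split.
    apply: openI => //; case: b.
      by apply: (@open_comp _ _ (fun f : weak_star V => (f : dual V) (xc (U s)).1 : R)
        [set r | (xc (U s)).2 + e < r]) => [f _|]; [exact: weak_star_eval|exact: open_gt].
    by apply: (@open_comp _ _ (fun f : weak_star V => (f : dual V) (xc (U s)).1 : R)
        [set r | r < (xc (U s)).2]) => [f _|]; [exact: weak_star_eval|exact: open_lt].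
  by case: b; [exists g|exists h].
pose x s := (xc (U s)).1; pose c s := (xc (U s)).2.
pose pre s := fix pre n : seq bool := if n is m.+1 then s m :: pre m else [::].
have fP s : exists f : dual V, forall n,
    if s n then c (pre s n) + e <= f (x (pre s n))
    else f (x (pre s n)) <= c (pre s n).
  pose G n : set (weak_star V) := 
    [set f | if s n then c (pre s n) + e <= (f : dual V) (x (pre s n))
    else (f : dual V) (x (pre s n)) <= c (pre s n)].
  have UG m n : (m < n)%N -> U (pre s n) `<=` G m.
    elim: n => // n IH; rewrite ltnS leq_eqVlt => /orP[/eqP -> f [_]|mn f [Uf _]].
      by rewrite /G /=; case: (s n) => /ltW.
    exact: IH.
  have [||n _|n _|m n _ _|f _ fG] := @compact_directed (weak_star V) (@dual_ball R V M) _
      [set: nat] (fun n => \bigcap_(m in [set m | (m < n)%N]) G m).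
  - exact: banach_alaoglu.
  - by exists 0%N.
  - apply: closed_bigI => m _; rewrite /G; case: (s m).
      exact: (@closed_eval _ _ _ [set r | _ <= r] (@closed_ge _ _)).
    exact: (@closed_eval _ _ _ [set r | r <= _] (@closed_le _ _)).
  - have [_ [f [Uf Lf]]] := UP (pre s n); exists f; split; first exact: LM.
    by move=> m mn; exact: UG Uf.
  - exists (maxn m n) => // f fG; split=> k /= kmn; apply: fG => /=.
      by rewrite leq_max kmn.
    by rewrite leq_max kmn orbT.
  by exists f => n; exact: (fG n.+1 I n (ltnSn n)).
have [f {}fP] := choice fP.
exists e, x, f; split => // [s|s t st]; first by have [] := xcP _ (UP s).1 (UP s).2.
have ex : exists n, s n != t n.
  apply: contrapT => nex; apply: st; apply/funext => n.
  by apply/eqP/negPn/negP => ne; apply: nex; exists n.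
have := ex_minnP ex; case=> n stn minn.
have pren : pre s n = pre t n.
  have : forall m, (m < n)%N -> s m = t m.
    move=> m mn; apply/eqP/negPn/negP => /minn.
    by rewrite leqNgt mn.
  elim: n {stn minn} => //= n IH h; rewrite h// IH// => m mn.
  by apply: h; rewrite ltnS ltnW.
exists (pre s n); have := fP s n; have := fP t n; rewrite -pren.
case: (s n) (t n) stn => [] [] // _ h1 h2.
  rewrite ler_normr; apply/orP; left; rewrite lerBrDl.
  by apply: le_trans h2; rewrite lerD2r.
rewrite distrC ler_normr; apply/orP; left; rewrite lerBrDl.
by apply: le_trans h1; rewrite lerD2r.
Qed.

End CantorTree.

(** The functionals on the branches of the tree restrict to an uncountable
    uniformly separated family on the closed span of the nodes.  The
    restrictions are measured in the original norm of [X], at the cost of the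
    equivalence constant [c]. *)
Lemma asplund_fragmented (R : realType) (X : completeNormedModType R)
    (N : equivalent_norm X) (M : R) :
  asplund X -> 0 <= M -> fragmented (renorm N) M.
Proof.
move=> aX M0; apply: contrapT => /(cantor_tree M0)[e [x [f [e0 x1 fx]]]].
have [U [cU sU xU]] := closed_separable_span (countable_range_of_countType (x : _ -> X)).
have [D [cD _ Dd]] := aX U cU sU.
have [c [C [c0 C0 cC]]] := eqnorm_equiv N.
have [g gf] : exists g : (nat -> bool) -> dual (subspace_of U), forall s u,
    g s u = f s (val u : renorm N).
  suff h s : exists g : dual (subspace_of U), forall u, g u = f s (val u : renorm N).
    by have [g gf] := choice h; exists g.
  apply: (@dual_of _ _ _ (`|f s| * C)) => [a u v|u].
    by rewrite -linearP.
  apply: le_trans (dual_normP' (f s) _) _; rewrite -mulrA ler_wpM2l//.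
  by have /andP[] := cC (val u).
(* [e * c / 3] leaves room for the triangle inequality: two thirds of [e] after
   division by [c]. *)
have eta0 : 0 < e * c / 3 by rewrite !mulr_gt0.
have [d dP] : exists d : (nat -> bool) -> dual (subspace_of U), forall s,
    D (d s) /\ `|g s - d s| < e * c / 3.
  suff h s : exists d, D d /\ `|g s - d| < e * c / 3.
    by have [d dP] := choice h; exists d.
  have [d [Dd' gd]] := Dd (g s) I _ (nbhsx_ballx (g s) _ eta0).
  by exists d; split => //; move: gd; rewrite -ball_normE.
apply: (no_countable_cantor cD (fun s => (dP s).1)) => s t dst.
apply: contrapT => /fx[p].
have xp : x p \in U by apply: xU; exists p.
pose u : subspace_of U := @SubspaceOf R X U (x p : X) xp.
apply/negP; rewrite -ltNge -(gf s u) -(gf t u).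
rewrite (_ : g s u - g t u = (g s - g t) u)//.
apply: le_lt_trans (dual_normP' _ _) _.
have u1 : `|u| <= c^-1.
  have /andP[h _] := cC (x p).
  by rewrite -[c^-1]mul1r ler_pdivlMr// mulrC (le_trans h)//; exact: x1.
have gst : `|g s - g t| <= e * c / 3 + e * c / 3.
  rewrite -(subrKA (d s)) (le_trans (ler_normD _ _))// lerD//.
    exact: ltW (dP s).2.
  by rewrite dst distrC ltW// (dP t).2.
apply: le_lt_trans (ler_pM _ _ gst u1) _ => //.
have ec0 : 0 < e * c by rewrite mulr_gt0.
rewrite ltr_pdivrMr// -mulrDl ltr_pdivrMr// -mulr2n -[ltLHS]mulr_natr ltr_pM2l//.
by rewrite ltr_nat.
Qed.

(** * Adjoint retractions of a dual ball *)

Lemma tails_filter d (G : porderType d) : up_directed G -> ProperFilter (tails G).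
Proof.
move=> [[s0] dG]; apply: filter_from_proper => [|s _]; last by exists s => /=.
apply: filter_from_filter; first by exists s0.
move=> s t _ _; have [u [su tu]] := dG s t; exists u => // v /= uv.
by split; [exact: le_trans su uv|exact: le_trans tu uv].
Qed.

Section BallTopology.
Context {R : realType} (Z : normedModType R).

Let K := @dual_ball R Z 1.

Definition ev (F : K) (z : Z) : R := (val F : dual Z) z.

Lemma ev_eq (F G : K) : (forall z, ev F z = ev G z) -> F = G.
Proof.
by move=> FG; apply/val_inj/val_inj/funext; exact: FG.
Qed.

Lemma ev_norm (F : K) : `|(val F : dual Z)| <= 1.
Proof. exact: (set_valP F). Qed.

Lemma ev_bound (F : K) z : `|ev F z| <= `|z|.
Proof.
apply: le_trans (dual_normP' _ _) _; rewrite ler_piMl//; exact: ev_norm.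
Qed.

Lemma evB (F : K) y z : ev F (y - z) = ev F y - ev F z.
Proof. exact: linearB. Qed.

Lemma evZ (F : K) a z : ev F (a *: z) = a * ev F z.
Proof. exact: linearZ. Qed.

Lemma ball_of (f : Z -> R) :
  (forall a x y, f (a *: x + y) = a * f x + f y) ->
  (forall x, `|f x| <= `|x|) -> exists F : K, forall z, ev F z = f z.
Proof.
move=> lf f1; have [|F Ff] := @dual_of R Z f 1 lf.
  by move=> x; rewrite mul1r.
have F1 : F \in (K : set (weak_star Z)).
  by apply/mem_set; apply: dual_norm_le => // x; rewrite Ff mul1r.
by exists (exist _ F F1).
Qed.

Lemma ev_continuous z : continuous (fun F : K => ev F z).
Proof.
move=> F; apply: (@continuous_comp K (weak_star Z) R
  (fun F : K => val F : weak_star Z) (fun g => (g : dual Z) z)).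
  exact: initial_continuous.
exact: weak_star_eval.
Qed.

Lemma ev_cvg (FF : set_system K) (F : K) : Filter FF ->
  (forall z, (fun G : K => ev G z) @ FF --> ev F z) -> FF --> F.
Proof.
move=> fFF h; apply: initial_cvg; apply: weak_star_cvg => z.
exact: h.
Qed.

End BallTopology.

Section Metrizability.
Context {R : realType} (Z : normedModType R).

Let K := @dual_ball R Z 1.

(** On [S] the weak-star topology is that of pointwise convergence on the
    sequence [d].  The vectors [b n] are the [d n] rescaled to norm at most
    [1 / (n + 1)], so that the supremum over [n] of the differences at [b n] is a
    metric controlled, up to any [e], by finitely many [n]. *)
Lemma ball_metrizable (S : set K) (d : nat -> Z) :
  (forall z e, 0 < e -> exists n, forall F G, S F -> S G ->
    `|ev F z - ev G z| <= `|ev F (d n) - ev G (d n)| + e) ->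
  metrizable R S.
Proof.
move=> dS.
pose c n : R := n.+1%:R * (1 + `|d n|).
have c0 n : 0 < c n by rewrite mulr_gt0// ltr_wpDr.
pose b n := (c n)^-1 *: d n.
have b_norm n : `|b n| <= n.+1%:R^-1.
  rewrite normrZ gtr0_norm ?invr_gt0// ler_pdivrMl// /c mulrAC divff ?mul1r//.
  by rewrite lerDr.
have evd n (F : K) : ev F (d n) = c n * ev F (b n).
  by rewrite evZ mulrA divff ?mul1r// gt_eqF.
pose D (x y : S) := [set `|ev (val x) (b n) - ev (val y) (b n)| | n in [set: nat]].
have evb (F : K) n : `|ev F (b n)| <= n.+1%:R^-1.
  exact: le_trans (ev_bound _ _) (b_norm n).
have Dsup x y : has_sup (D x y).
  split; first by exists `|ev (val x) (b 0%N) - ev (val y) (b 0%N)|, 0%N.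
  exists (1 + 1) => _ [n _ <-]; rewrite (le_trans (ler_normB _ _))//.
  by rewrite lerD// (le_trans (evb _ _))// invf_le1// ler1n.
pose dist x y := sup (D x y).
have distP x y n : `|ev (val x) (b n) - ev (val y) (b n)| <= dist x y.
  by apply: ub_le_sup; [case: (Dsup x y)|exists n].
have dist_le x y M : (forall n, `|ev (val x) (b n) - ev (val y) (b n)| <= M) ->
    dist x y <= M.
  by move=> h; apply: ge_sup; [case: (Dsup x y)|move=> _ [n _ <-]].
have Sval (x : S) : S (val x) by exact: set_valP.
exists dist; split.
- move=> x y; split=> [xy|->]; last first.
    apply/eqP; rewrite eq_le; apply/andP; split.
      by apply: dist_le => n; rewrite subrr normr0.
    exact: le_trans (normr_ge0 _) (distP _ _ 0%N).
  apply/val_inj/ev_eq => z; apply/eqP; rewrite -subr_eq0 -normr_le0.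
  apply/ler_addgt0Pr => e /(dS z)[n /(_ _ _ (Sval x) (Sval y)) h].
  rewrite (le_trans h)// lerD2r !evd -mulrBr normrM mulr_ge0_le0//.
  by rewrite -xy distP.
- move=> x y; congr sup; apply/seteqP.
  by split=> _ [n _ <-]; exists n => //; rewrite distrC.
- move=> x y z; apply: dist_le => n; apply: le_trans (ler_distD (ev (val y) (b n)) _ _) _.
  by rewrite lerD// distP.
move=> x; apply/seteqP; split=> [U Ux|U [e /= e0 eU]]; last first.
  apply: filterS eU _.
  have e20 : 0 < e / 2 by rewrite divr_gt0.
  have [m me] := exists_invS_le (divr_gt0 e20 (ltr0Sn R 1)).
  have near_n n : \forall y \near x, `|ev (val x) (b n) - ev (val y) (b n)| < e / 2.
    have cn : continuous (fun y : S => ev (val y) (b n)).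
      move=> y; apply: (@continuous_comp S K R (fun y : S => val y : K)
        (fun F : K => ev F (b n))).
        exact: initial_continuous.
      exact: ev_continuous.
    have /cvgrPdist_lt := cn x; apply.
    by rewrite divr_gt0.
  have near_all k : \forall y \near x, forall n, (n < k)%N ->
      `|ev (val x) (b n) - ev (val y) (b n)| < e / 2.
    elim: k => [|k IH]; first by apply: (@nearW _ (nbhs x)) => y n.
    apply: (@filterS2 _ (nbhs x) _ _ _ _ _ (near_n k) IH) => y yk yIH n.
    by rewrite ltnS leq_eqVlt => /orP[/eqP ->|/yIH].
  apply: filterS (near_all m) => y ym /=.
  apply: (@le_lt_trans _ _ (e / 2)); last by rewrite ltr_pdivrMr// ltr_pMr// ltr1n.
  apply: dist_le => n; have [nm|mn] := ltnP n m; first by rewrite ltW// ym.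
  have bn (F : K) : `|ev F (b n)| <= e / 2 / 2.
    rewrite (le_trans (evb _ _))// (le_trans _ me)//.
    by rewrite lef_pV2 ?posrE// ler_nat ltnS.
  rewrite (le_trans (ler_normB _ _))// [leRHS]splitr.
  exact: lerD.
pose FF : set_system S := filter_from [set e : R | 0 < e] (fun e => [set y | dist x y < e]).
have FFF : Filter FF.
  apply: filter_from_filter; first by exists 1 => /=.
  move=> i j /= i0 j0; exists (Num.min i j); first by rewrite /= lt_min i0.
  by move=> y /=; rewrite lt_min => /andP[].
suff h : FF --> x by exact: h.
apply: initial_cvg; apply: ev_cvg => z.
apply/cvgrPdist_le => e e0.
have e20 : 0 < e / 2 by rewrite divr_gt0.
have [n h] := dS z _ e20; exists (e / 2 / c n) => /=; first by rewrite divr_gt0.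
move=> y /= xy; rewrite (le_trans (h _ _ (Sval x) (Sval y)))//.
rewrite !evd -mulrBr normrM (gtr0_norm (c0 n)) [leRHS](splitr e) lerD2r.
rewrite mulrC -ler_pdivlMr// (le_trans (distP x y n))//.
exact: ltW.
Qed.

End Metrizability.

Section DualSkeleton.
Context {R : realType} (Z : completeNormedModType R).

Let K := @dual_ball R Z 1.

(** The range of [F |-> F \o P s] is determined by values on the separable range
    of [P s], which gives metrizability.  Continuity along increasing sequences
    is the strong convergence [P (u n) z --> P t z], true on the dense union of
    the ranges and extended by the uniform bound [`|P s| <= 1]. *)
Theorem dual_retractional_skeleton :
  has_projectional_skeleton Z 1 -> has_retractional_skeleton R K.
Proof.
move=> [d [G [P [[Gdir Gsig Pc Pp Psep Pcov Pcomp Psup] P1]]]].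
have Pnorm s z : `|P s z| <= `|z|.
  apply: le_trans (opnormP _ (Pc s)) _; rewrite ler_piMl//; exact: P1.
have [r rP] : exists r : G -> K -> K, forall s F z, ev (r s F) z = ev F (P s z).
  have h s (F : K) : exists F' : K, forall z, ev F' z = ev F (P s z).
    apply: ball_of => [a x y|x].
      by rewrite linearP -evZ /ev linearD.
    exact: le_trans (ev_bound _ _) (Pnorm _ _).
  have h' s : exists q : K -> K, forall F z, ev (q F) z = ev F (P s z).
    by have [q qP] := choice (h s); exists q.
  by have [r rP] := choice h'; exists r.
have PP s z : P s (P s z) = P s z.
  by have := congr1 (fun f : Z -> Z => f z) (Pp s).
have Pst s t z : (s <= t)%O -> P s (P t z) = P s z /\ P t (P s z) = P s z.
  move=> /Pcomp[h1 h2]; split; first by rewrite [RHS](congr1 (fun f : Z -> Z => f z) h1).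
  by rewrite [RHS](congr1 (fun f : Z -> Z => f z) h2).
have tF : ProperFilter (tails G) by exact: tails_filter.
exists d, G, r; split => //.
- move=> s F; apply: (@ev_cvg _ _ (r s @ nbhs F)) => z.
  suff : (fun F' => ev (r s F') z) @ nbhs F --> ev (r s F) z by [].
  rewrite rP (_ : (fun F' => _) = (fun F' : K => ev F' (P s z))).
    exact: ev_continuous.
  by apply/funext => F'; rewrite rP.
- by move=> s; apply/funext => F /=; apply: ev_eq => z; rewrite !rP PP.
- move=> s; have [D [cD DP PD]] := Psep s.
  have /countable_injP[h hD] := cD.
  apply: (@ball_metrizable _ _ _ (fun n => xget 0 [set z | D z /\ h z = n])).
  move=> z e e0; have e20 : 0 < e / 2 by rewrite divr_gt0.
  have [y [Dy]] := PD (P s z) (imageT _ _) _ (nbhsx_ballx (P s z) _ e20).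
  rewrite -ball_normE /= => zy; exists (h y).
  have -> : xget 0 [set z | D z /\ h z = h y] = y.
    case: xgetP => [w _ [Dw hw]|/(_ y)]; last by case.
    by apply: hD => //; rewrite inE.
  move=> _ _ [F _ <-] [F' _ <-]; rewrite ![ev _ z]rP.
  have hy (F0 : K) : `|ev F0 (P s z) - ev (r s F0) y| <= e / 2.
    have [w _ wy] := DP _ Dy.
    rewrite rP -wy PP wy -evB; apply: le_trans (ev_bound _ _) _.
    exact: ltW.
  rewrite (_ : _ - _ = (ev (r s F) y - ev (r s F') y) +
    ((ev F (P s z) - ev (r s F) y) - (ev F' (P s z) - ev (r s F') y))); last first.
    by rewrite opprB [in RHS]addrACA addKr addrCA subrr addr0.
  rewrite (le_trans (ler_normD _ _))// lerD2l (le_trans (ler_normB _ _))//.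
  by rewrite [leRHS]splitr lerD.
- move=> F; apply: ev_cvg => z.
  have [s _ [y _ yz]] : (\bigcup_s range (P s)) z by rewrite -Pcov.
  apply: cvg_near_cst; exists s => // t /= st.
  by rewrite rP -yz (Pst s t y st).2.
- move=> s t st; split; apply/funext => F; apply: ev_eq => z; rewrite /= !rP.
    by rewrite (Pst s t z st).2.
  by rewrite (Pst s t z st).1.
- move=> u t u_inc ut F; apply: ev_cvg => z.
  apply/cvgrPdist_le => e e0; have e20 : 0 < e / 2 by rewrite divr_gt0.
  have : closure (\bigcup_n range (P (u n))) (P t z).
    by rewrite -(Psup u t u_inc ut); exists z.
  move=> /(_ _ (nbhsx_ballx (P t z) _ e20))[w [[m _ [v _ vw]]]].
  rewrite -ball_normE /= => zw.
  exists m => // n /= mn; rewrite !rP -evB.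
  apply: le_trans (ev_bound _ _) _.
  have unt : (u n <= t)%O by case: ut => ub _; apply: ub; exists n.
  have umn : (u m <= u n)%O by rewrite u_inc.
  rewrite -(Pst _ _ z unt).1 (_ : _ - _ = (P t z - w) - P (u n) (P t z - w)).
    rewrite (le_trans (ler_normB _ _))// [leRHS]splitr lerD// ?(ltW zw)//.
    exact: le_trans (Pnorm _ _) (ltW zw).
  by rewrite linearB /= -[in P (u n) w]vw (Pst _ _ v umn).2 vw opprB addrA subrK.
Qed.

End DualSkeleton.

(** * A norm with many weak-star G-delta points *)

Section Renorming.
Context {R : realType} {X : normedModType R} (a : nat -> X).

Variable xs : nat -> dual X.
Hypothesis xs1 : forall n, `|xs n| <= 1.
Hypothesis xsa : forall n, xs n (a n) = `|a n|.

(** The projection along [a n] onto the kernel of [xs n]; the identity if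
    [a n = 0]. *)
Definition dproj n (x : X) : X := x - (xs n x / `|a n|) *: a n.

Lemma dproj_linear n b x y : dproj n (b *: x + y) = b *: dproj n x + dproj n y.
Proof.
rewrite /dproj linearP mulrDl scalerDl opprD addrACA scalerBr scalerA.
by congr (_ - _ *: _ + _); rewrite -mulrA.
Qed.

Lemma dproj_norm n x : `|dproj n x| <= 2 * `|x|.
Proof.
rewrite mulrDl mul1r (le_trans (ler_normB _ _))// lerD2l normrZ normrM normfV.
rewrite normr_id -mulrA.
have xsx : `|xs n x| <= `|x|.
  by rewrite (le_trans (dual_normP' _ _))// ler_piMl.
have [->|an0] := eqVneq (a n) 0; first by rewrite normr0 !mulr0.
by rewrite mulVf ?mulr1// normr_eq0.
Qed.

Lemma dproj_near n x : `|dproj n x| <= 2 * `|x - a n|.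
Proof.
have an : dproj n (a n) = 0.
  rewrite /dproj xsa; have [->|an0] := eqVneq (a n) 0.
    by rewrite scaler0 subrr.
  by rewrite divff ?normr_eq0// scale1r subrr.
have := dproj_norm n (x - a n).
by rewrite -[x - a n]addrC -scaleN1r dproj_linear an scaler0 add0r.
Qed.

Definition weight (n : nat) : R := 2^-1 ^+ n.+1.

Lemma weight_gt0 n : 0 < weight n. Proof. by rewrite exprn_gt0// invr_gt0. Qed.

Lemma sum_weight k : \sum_(i < k) weight i = 1 - 2^-1 ^+ k.
Proof.
elim: k => [|k IH]; first by rewrite big_ord0 expr0 subrr.
rewrite big_ord_recr /= IH /weight -addrA; congr (_ + _).
rewrite [in LHS](_ : 2^-1 ^+ k = 2^-1 ^+ k.+1 + 2^-1 ^+ k.+1).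
  by rewrite opprD addrNK.
by rewrite exprS -mulrDl -[2^-1 + _](_ : 1 = _) ?mul1r// [LHS]splitr mul1r.
Qed.

Definition psum k x := \sum_(i < k) weight i * `|dproj i x|.

Lemma psum_le k x : psum k x <= 2 * `|x|.
Proof.
apply: (@le_trans _ _ (\sum_(i < k) weight i * (2 * `|x|))).
  by apply: ler_sum => i _; rewrite ler_wpM2l ?dproj_norm// ltW// weight_gt0.
rewrite -mulr_suml ler_piMl ?mulr_ge0// sum_weight gerBl.
by rewrite exprn_ge0// invr_ge0.
Qed.

Lemma psum_nd x : {homo psum ^~ x : m n / (m <= n)%N >-> m <= n}.
Proof.
move=> m n /subnK <-; elim: (n - m)%N => // k IH; apply: le_trans IH _.
by rewrite addSn /psum big_ord_recr /= lerDl mulr_ge0// ltW// weight_gt0.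
Qed.

Definition tsum x := sup [set psum k x | k in [set: nat]].

Lemma tsum_has_sup x : has_sup [set psum k x | k in [set: nat]].
Proof.
split; first by exists (psum 0%N x), 0%N.
by exists (2 * `|x|) => _ [k _ <-]; exact: psum_le.
Qed.

Lemma psum_tsum k x : psum k x <= tsum x.
Proof. by apply: ub_le_sup; [case: (tsum_has_sup x)|exists k]. Qed.

Lemma tsum_le x M : (forall k, psum k x <= M) -> tsum x <= M.
Proof.
by move=> h; apply: ge_sup; [case: (tsum_has_sup x)|move=> _ [k _ <-]].
Qed.

Definition rnorm x := `|x| + tsum x.

Lemma rnorm_bound x : 1 * `|x| <= rnorm x <= 3 * `|x|.
Proof.
rewrite mul1r lerDl (le_trans _ (psum_tsum 0 x)) ?/psum ?big_ord0//=.
rewrite (_ : 3 * `|x| = `|x| + 2 * `|x|); last first.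
  by rewrite -[in RHS](mul1r `|x|) mulrA mulr1 -mulrDl.
by rewrite lerD2l; apply: tsum_le => k; exact: psum_le.
Qed.

Lemma rnormD x y : rnorm (x + y) <= rnorm x + rnorm y.
Proof.
rewrite /rnorm addrACA lerD ?ler_normD//; apply: tsum_le => k.
apply: le_trans (lerD (psum_tsum k x) (psum_tsum k y)).
rewrite /psum -big_split /=; apply: ler_sum => i _.
rewrite -mulrDr ler_wpM2l ?(ltW (weight_gt0 _))//.
by rewrite -[x]scale1r dproj_linear !scale1r ler_normD.
Qed.

Lemma rnormZ b x : rnorm (b *: x) = `|b| * rnorm x.
Proof.
have psumZ k c z : psum k (c *: z) = `|c| * psum k z.
  rewrite /psum mulr_sumr; apply: eq_bigr => i _.
  have := dproj_linear i c z 0; rewrite addr0.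
  rewrite (_ : dproj i 0 = 0); first by rewrite addr0 => ->; rewrite normrZ mulrCA.
  by rewrite /dproj linear0 mul0r scale0r subr0.
have le c z : tsum (c *: z) <= `|c| * tsum z.
  by apply: tsum_le => k; rewrite psumZ ler_wpM2l// psum_tsum.
rewrite /rnorm normrZ mulrDr; congr (_ + _); apply/eqP; rewrite eq_le le /=.
have [->|b0] := eqVneq b 0.
  rewrite normr0 mul0r; apply: le_trans (psum_tsum 0 _).
  by rewrite /psum big_ord0.
have nb : 0 < `|b| by rewrite normr_gt0.
by rewrite mulrC -ler_pdivlMr// mulrC -normfV -{1}(scale1r x) -(mulVf b0) -scalerA le.
Qed.

Lemma rnorm0 x : rnorm x = 0 -> x = 0.
Proof.
move=> x0; apply/eqP; rewrite -normr_le0 -x0 -[`|x|]mul1r.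
by have /andP[] := rnorm_bound x.
Qed.

(** The summands are kept separate in the norm because a functional on the bidual
    that nearly attains the whole sum must nearly attain each of them. *)
Definition exposing_norm : equivalent_norm X.
Proof.
refine (EquivalentNorm rnormD rnormZ rnorm0 _).
by exists 1, 3; split => // x; exact: rnorm_bound.
Defined.

Let V := renorm exposing_norm.

Lemma rnormE (x : V) : `|x| = rnorm x. Proof. by []. Qed.

Lemma dual_to_renorm (f : dual X) : exists g : dual V, forall x, g x = f x.
Proof.
apply: (@dual_of _ _ _ `|f|) => [b x y|x]; first exact: linearP.
rewrite (le_trans (dual_normP' f _))// ler_wpM2l// rnormE -[leLHS]mul1r.
by have /andP[] := rnorm_bound x.
Qed.

(** The functionals [g] are one norming [x], those norming [dproj n x] composed
    with [dproj n], and the [xs n].  Replacing in a partial sum of the norming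
    functionals the [n]-th one by [z1 \o dproj n], with [z1] any functional of
    norm at most one, stays in the dual ball; evaluating [F] there bounds
    [F (z1 \o dproj n)] by [`|dproj n x|], and [z1 \o dproj n] differs from [z1]
    by a multiple of [xs n], where [F] is known.  Hence [F z1 - z1 x] is at most
    [2 * `|dproj n x|], which is small for suitable [n]. *)
Lemma unit_vector_determined (x : X) : rnorm x = 1 ->
  (forall e, 0 < e -> exists n, `|x - a n| < e) ->
  exists g : nat -> dual V, forall F : dual (dual V), `|F| <= 1 ->
    (forall k, F (g k) = g k (x : V)) -> forall z, F z = z (x : V).
Proof.
move=> x1 xa.
have [y0 [y0x y01]] := norming_functional x.
have [y yE] := dual_to_renorm y0.
have [xs' xs'E] := choice (fun n => dual_to_renorm (xs n)).
have compP (f : dual X) n : exists g : dual V, forall u, g u = f (dproj n u).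
  have lin b u v : f (dproj n (b *: u + v)) = b * f (dproj n u) + f (dproj n v).
    by rewrite dproj_linear linearP.
  have [|g gE] := @dual_of _ X (fun u => f (dproj n u)) (`|f| * 2) lin.
    move=> u; rewrite (le_trans (dual_normP' _ _))// -mulrA ler_wpM2l//.
    exact: dproj_norm.
  by have [h hE] := dual_to_renorm g; exists h => u; rewrite hE gE.
have [yn ynE] : exists yn : nat -> dual V, forall n, yn n (x : V) = `|dproj n x| /\
    forall u : V, `|yn n u| <= `|dproj n u|.
  suff h n : exists f : dual V, f (x : V) = `|dproj n x| /\
    forall u : V, `|f u| <= `|dproj n u| by have [yn ynE] := choice h; exists yn.
  have [f [fx f1]] := norming_functional (dproj n x).
  have [g gE] := compP f n; exists g; split; first by rewrite gE.
  by move=> u; rewrite gE (le_trans (dual_normP' _ _))// ler_piMl.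
(* Three families interleaved: [y] at 0, [yn n] at [2n + 1], [xs' n] at
   [2n + 2]. *)
exists (fun k => if odd k then yn k./2 else if k./2 is n.+1 then xs' n else y).
move=> F F1 Fg.
have Fy : F y = `|x| by have := Fg 0%N; rewrite /= yE y0x.
have Fyn n : F (yn n) = `|dproj n x|.
  by have := Fg n.*2.+1; rewrite /= odd_double /= uphalf_double (ynE n).1.
have Fxs n : F (xs' n) = xs n x.
  by have := Fg n.+1.*2; rewrite odd_double doubleK xs'E.
suff Fle z : F z <= z (x : V).
  move=> z; apply/eqP; rewrite eq_le Fle /=.
  have : F (- z) <= - z (x : V) := Fle (- z).
  by rewrite linearN lerN2.
apply/ler_addgt0Pr => e e0.
pose c := 3 * `|z| + 1.
have c0 : 0 < c by rewrite ltr_wpDl// mulr_ge0.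
have zc u : `|z u| <= c * `|u : X|.
  rewrite (le_trans (dual_normP' _ _))// rnormE.
  have /andP[_ h] := rnorm_bound u; rewrite (le_trans (ler_wpM2l (normr_ge0 _) h))//.
  by rewrite mulrA ler_wpM2r// mulrC /c lerDl.
have [n xn] := xa (e / (4 * c)) (divr_gt0 e0 (mulr_gt0 (ltr0Sn _ 3) c0)).
have [z1 z1E] : exists z1 : dual X, forall u, z1 u = c^-1 * z u.
  apply: (@dual_of _ _ _ 1) => [b u v|u].
    rewrite (_ : z (b *: u + v) = b * z u + z v); last exact: (linearP z).
    by rewrite mulrDr [b * (_ * _)]mulrCA.
  by rewrite normrM gtr0_norm ?invr_gt0// ler_pdivrMl// mul1r.
have [zp zpE] := compP z1 n.
pose G i := if i == n then zp else yn i.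
have z1le u : `|z1 u| <= `|u|.
  by rewrite z1E normrM gtr0_norm ?invr_gt0// ler_pdivrMl.
have G_le i u : `|G i u| <= `|dproj i u|.
  by rewrite /G; case: eqP => [->|_]; [rewrite zpE z1le|exact: (ynE i).2].
have key k : (n < k)%N -> weight n * (F zp - `|dproj n x|) <= tsum x - psum k x.
  move=> nk; pose W : dual V := y + \sum_(i < k) weight i *: G i.
  have WE (u : V) : W u = y u + \sum_(i < k) weight i * G i u.
    rewrite /W dualD; congr (_ + _).
    by elim/big_ind2 : _ => // f b g d <- <-.
  have W1 : `|W| <= 1.
    apply: dual_norm_le => // u; rewrite mul1r rnormE WE (le_trans (ler_normD _ _))//.
    rewrite lerD//.
      by rewrite yE (le_trans (dual_normP' _ _))// ler_piMl.
    apply: le_trans (psum_tsum k u); apply: le_trans (ler_norm_sum _ _ _) _.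
    apply: ler_sum => i _; rewrite normrM gtr0_norm ?weight_gt0// ler_wpM2l//.
    exact: ltW (weight_gt0 _).
  have FW : F W <= 1.
    apply: le_trans (ler_norm _) _; apply: le_trans (dual_normP' _ _) _.
    by rewrite mulr_ile1.
  move: FW; rewrite linearD linear_sum /= Fy -x1 /rnorm lerD2l => FW.
  rewrite lerBrDr; apply: le_trans FW.
  rewrite /psum (bigD1 (Ordinal nk))//= [leRHS](bigD1 (Ordinal nk))//=.
  rewrite addrA -mulrDr subrK {1}/G eqxx linearZ /= lerD2l.
  apply: ler_sum => i; rewrite -val_eqE /= => ni.
  by rewrite linearZ /= /G (negbTE ni) Fyn.
have Fzp : F zp <= `|dproj n x|.
  rewrite -subr_le0 -(ler_pM2l (weight_gt0 n)) mulr0.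
  apply/ler_addgt0Pr => d d0; rewrite add0r.
  have [_ [k _ <-] kd] := sup_adherent d0 (tsum_has_sup x).
  have /le_trans -> // := key (maxn k n.+1) (leq_maxr _ _).
  rewrite lerBlDr -lerBlDl (le_trans (ltW kd))//.
  by apply: psum_nd; exact: leq_maxl.
have [z1' z1'E] := dual_to_renorm z1.
have zp_dec : zp = z1' - (z1 (a n) / `|a n|) *: xs' n.
  apply/val_inj/funext => u; rewrite -[LHS]/(zp u).
  rewrite -[RHS]/(z1' u - (z1 (a n) / `|a n|) * xs' n u).
  rewrite zpE z1'E xs'E /dproj linearB linearZ /=; congr (_ - _).
  rewrite -[LHS]/(xs n u / `|a n| * z1 (a n)).
  by rewrite mulrC mulrA mulrAC.
have z1'z : z1' = c^-1 *: z by apply/val_inj/funext => u; rewrite -[LHS]/(z1' u) z1'E z1E.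
have Fz1 : F z1' - z1 x <= 2 * `|dproj n x|.
  have -> : z1 x = z1 (dproj n x) + (z1 (a n) / `|a n|) * xs n x.
    rewrite /dproj linearB linearZ /=.
    rewrite (_ : (xs n x / `|a n|) *: z1 (a n) = z1 (a n) / `|a n| * xs n x).
      by rewrite subrK.
    by rewrite -[LHS]/(xs n x / `|a n| * z1 (a n)) mulrC mulrA mulrAC.
  have -> : F z1' = F zp + (z1 (a n) / `|a n|) * xs n x.
    by rewrite zp_dec linearB linearZ /= Fxs subrK.
  rewrite opprD addrACA subrr addr0 mulrDl mul1r lerD//.
  by rewrite (le_trans (ler_norm _))// normrN z1le.
move: Fz1; rewrite z1'z linearZ /= z1E -mulrBr ler_pdivrMl// lerBlDl => /le_trans; apply.
rewrite lerD2l.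
apply: (@le_trans _ _ (c * (2 * (2 * `|x - a n|)))).
  by rewrite ler_wpM2l ?(ltW c0)// ler_wpM2l// dproj_near.
rewrite mulrA mulrA [X in X * _](_ : _ = 4 * c); last by rewrite -mulrA -natrM mulrC.
by rewrite mulrC -ler_pdivlMr ?mulr_gt0// ltW.
Qed.

End Renorming.

(** * Countably determined points lie in the range of a retraction *)

Section ExposedPoints.
Context {R : realType} (Z : normedModType R).

Let K := @dual_ball R Z 1.

(** Choose indices [u n] increasing so fast that [r t F] is close to [F] at the
    first [n] functionals whenever [u n <= t]; the retraction at the supremum of
    the [u n] then agrees with [F] at all of them.  A strictly increasing
    sequence exists unless the index set has a maximum, and at a maximum the
    retraction fixes everything. *)
Lemma determined_in_range d (G : porderType d) (r : G -> K -> K) (F : K)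
    (g : nat -> Z) : retractional_skeleton R r ->
  (forall F' : K, (forall k, ev F' (g k) = ev F (g k)) -> F' = F) ->
  exists s, r s F = F.
Proof.
move=> [Gdir Gsig rc rr rm rcvg rcomp rsup] gF.
have tF : ProperFilter (tails G) by exact: tails_filter.
have near_g n (e : R) : 0 < e -> exists s, forall t, (s <= t)%O ->
    forall k, (k < n)%N -> `|ev F (g k) - ev (r t F) (g k)| <= e.
  move=> e0; elim: n => [|n [s sP]]; first by have [[s0] _] := Gdir; exists s0.
  have : (fun t => ev (r t F) (g n)) @ tails G --> ev F (g n).
    apply: (@cvg_comp _ _ _ (fun t => r t F) (fun F' : K => ev F' (g n)) _ (nbhs F)).
      exact: rcvg.
    exact: ev_continuous.
  move=> /cvgrPdist_le /(_ _ e0)[s' _ s'P].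
  have [u [su s'u]] := Gdir.2 s s'; exists u => t ut k.
  rewrite ltnS leq_eqVlt => /orP[/eqP ->|kn]; first exact/s'P/(le_trans s'u).
  exact: sP (le_trans su ut) _ kn.
have [[m mmax]|nomax] := pselect (exists m : G, forall s, (m <= s)%O -> s = m).
  exists m; apply: gF => k; apply/eqP; rewrite -subr_eq0 -normr_le0 distrC.
  apply/ler_addgt0Pr => e e0; rewrite add0r.
  have [s sP] := near_g k.+1 e e0; have [u [mu su]] := Gdir.2 m s.
  by have := sP u su k (ltnSn k); rewrite (mmax u mu).
pose step (ns : nat * G) t0 := (ns.2 < t0)%O /\ forall t, (t0 <= t)%O ->
  forall k, (k < ns.1)%N -> `|ev F (g k) - ev (r t F) (g k)| <= ns.1.+1%:R^-1.
have ex_step ns : exists t0, step ns t0.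
  case: ns => n s.
  have [s1 ss1] : exists s1, (s < s1)%O.
    apply: contrapT => ns; apply: nomax; exists s => s1.
    by rewrite le_eqVlt => /orP[/eqP //|ss1]; case: ns; exists s1.
  have [|s2 s2P] := near_g n n.+1%:R^-1; first by [].
  have [u [s1u s2u]] := Gdir.2 s1 s2; exists u; split; first exact: lt_le_trans s1u.
  by move=> t ut; apply: s2P; exact: le_trans ut.
have [nxt nxtP] := choice ex_step.
have [[s0] _] := Gdir.
pose u := fix u n := if n is m.+1 then nxt (n, u m) else s0.
have u_inc : increasing_seq u by apply/increasing_seqP => n; exact: (nxtP (n.+1, u n)).1.
have u_nd : nondecreasing_seq u by move=> m n; rewrite u_inc.
have [t ut] := Gsig u u_nd; exists t; apply: gF => k.
have h1 : (fun n => ev (r (u n) F) (g k)) @ \oo --> ev (r t F) (g k).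
  apply: (@cvg_comp _ _ _ (fun n => r (u n) F) (fun F' : K => ev F' (g k)) _
    (nbhs (r t F))); first exact: rsup.
  exact: ev_continuous.
have h2 : (fun n => ev (r (u n) F) (g k)) @ \oo --> ev F (g k).
  apply/cvgrPdist_le => e e0; have [m me] := exists_invS_le e0.
  exists (maxn m k).+1 => // -[//|n] /=; rewrite ltnS geq_max => /andP[mn kn].
  have /= := (nxtP (n.+1, u n)).2 _ (lexx _) k; rewrite ltnS => /(_ kn) h.
  apply: le_trans h _; apply: le_trans me.
  by rewrite lef_pV2 ?posrE// ler_nat ltnS (leq_trans mn).
exact: (cvg_unique _ h1 h2).
Qed.

End ExposedPoints.

(** * Uniform separability of continuous functions on a compact metrizable space *)

Lemma compact_set_type (T : topologicalType) (A : set T) :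
  compact A -> compact [set: A].
Proof.
rewrite !compact_ultra => cA F FU _.
have [|x [Ax Fx]] := cA ((fun y : A => val y) @ F) (fmap_ultra _ FU).
  by apply: (@filterS _ F _ _ _ _ filterT) => y _; exact: set_valP.
exists (exist _ x (mem_set Ax)); split => //.
by apply: initial_cvg; exact: Fx.
Qed.

Section CompactMetrizable.
Context {R : realType}.

Lemma compact_metrizable_base (T : topologicalType) : compact [set: T] ->
  metrizable R T -> exists B : nat * nat -> set T, (forall i, open (B i)) /\
    forall x U, nbhs x U -> exists2 i, B i x & B i `<=` U.
Proof.
move=> cT [dist [d0 dC dD dN]].
have open_ball x e : open [set y | dist x y < e].
  rewrite openE => y /= xy; rewrite /interior dN.
  exists (e - dist x y); first by rewrite /= subr_gt0.
  move=> z /= yz; rewrite (le_lt_trans (dD _ y _))//.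
  by rewrite -ltrBrDl.
have dxx x : dist x x = 0 by apply/d0.
have net k : exists s : seq (set T), (forall W, W \in s -> exists x,
      W = [set y | dist x y < k.+1%:R^-1]) /\
    forall x, exists2 W, W \in s & W x.
  have [x _|s sP scov] := @compact_finite_cover T setT
      (fun W => exists x, W = [set y | dist x y < k.+1%:R^-1]) cT.
    exists [set y | dist x y < k.+1%:R^-1]; split; last by exists x.
      exact: open_ball.
    by rewrite /= dxx.
  by exists s; split => // x; exact: scov.
have [L LP] := choice net.
exists (fun i => nth set0 (L i.1) i.2); split=> [[k j]|x U] /=.
  have [jL|jL] := ltnP j (size (L k)); last by rewrite nth_default//; exact: open0.
  by have [x ->] := (LP k).1 _ (mem_nth set0 jL); exact: open_ball.
rewrite dN => -[e /= e0 eU].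
have [k ke] := exists_invS_le (divr_gt0 e0 (ltr0Sn R 1)).
have [W WL Wx] := (LP k).2 x; exists (k, index W (L k)); rewrite /= nth_index//.
have [c Wc] := (LP k).1 _ WL; rewrite Wc in Wx *.
move=> y /= cy; apply: eU => /=; rewrite (le_lt_trans (dD _ c _))// dC.
by rewrite [e]splitr ltrD// ?(lt_le_trans Wx)// (lt_le_trans cy).
Qed.

(** A function is coded, up to [e], by a finite list of basic open sets covering
    the space and a rational value on each of them; there are countably many
    codes, and one function is chosen for each code in use. *)
Lemma compact_metrizable_separable (T : topologicalType) (I : pointedType)
    (ph : I -> T -> R) :
  compact [set: T] -> metrizable R T -> (forall i, continuous (ph i)) ->
  forall e, 0 < e -> exists2 D : set I, countable D &
    forall i, exists2 j, D j & forall x, `|ph i x - ph j x| <= e.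
Proof.
move=> cT mT cph e e0; have [B [oB nB]] := compact_metrizable_base cT mT.
have e20 : 0 < e / 2 by rewrite divr_gt0.
pose good i (s : seq (nat * nat * rat)) :=
  (forall p, p \in s -> forall x, B p.1 x -> `|ph i x - ratr p.2| <= e / 2) /\
  (forall x, exists2 p, p \in s & B p.1 x).
have ex_good i : exists s, good i s.
  have [x _|s sP scov] := @compact_finite_cover T setT (fun W => exists p : nat * nat * rat,
     W = B p.1 /\ forall x, B p.1 x -> `|ph i x - ratr p.2| <= e / 2) cT.
    have [|q] := @rat_in_itvoo R (ph i x - e / 2 / 2) (ph i x).
      by rewrite gtrBl divr_gt0.
    rewrite in_itv /= => /andP[lq qu].
    have : nbhs x [set y | `|ph i x - ph i y| < e / 2 / 2].
      by have /cvgrPdist_lt := cph i x; apply; rewrite divr_gt0.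
    move=> /nB[k Bkx BkU]; exists (B k); split => //.
    exists (k, q); split => // y /BkU /= xy.
    rewrite -(subrKA (ph i x)) (le_trans (ler_normD _ _))// distrC [leRHS]splitr.
    by rewrite lerD ?(ltW xy)// ger0_norm ?subr_ge0 ?(ltW qu)// lerBlDr -lerBlDl ltW.
  pose pk W : nat * nat * rat := xget (0%N, 0%N, 0)
    [set p | W = B p.1 /\ forall x, B p.1 x -> `|ph i x - ratr p.2| <= e / 2].
  have pkP W : W \in s ->
      W = B (pk W).1 /\ forall x, B (pk W).1 x -> `|ph i x - ratr (pk W).2| <= e / 2.
    by move=> /sP[p pP]; rewrite /pk; case: xgetP => [q _ //|/(_ p)]; case.
  exists (map pk s); split=> [_ /mapP[W Ws ->]|x]; first by have [] := pkP _ Ws.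
  have [W Ws Wx] := scov x Logic.I; exists (pk W); first exact: map_f.
  by rewrite -(pkP _ Ws).1.
exists (range (fun s => xget point [set i | good i s])).
  exact: countable_range_of_countType.
move=> i; have [s gs] := ex_good i.
exists (xget point [set i | good i s]); first by exists s.
have gj : good (xget point [set i | good i s]) s.
  by case: xgetP => [j _ //|/(_ i)].
move=> x; have [p ps px] := gs.2 x.
rewrite -(subrKA (ratr p.2)) (le_trans (ler_normD _ _))// [leRHS]splitr lerD//.
  exact: gs.1.
by rewrite distrC; exact: gj.1.
Qed.

End CompactMetrizable.

(** * Retractional skeletons force the Asplund property *)

Lemma dense_sequence (R : realType) (X : normedModType R) (S : set X) :
  S 0 -> separable S -> exists a : nat -> X, (forall n, S (a n)) /\
    forall x e, S x -> 0 < e -> exists n, `|x - a n| < e.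
Proof.
move=> S0 [D [/countable_injP[h hD] DS SD]].
pose a n := xget 0 [set x | D x /\ h x = n].
exists a; split=> [n|x e Sx e0].
  by rewrite /a; case: xgetP => [y _ [/DS]|].
have [y [Dy]] := SD x Sx _ (nbhsx_ballx x _ e0).
rewrite -ball_normE /= => xy; exists (h y).
suff -> : a (h y) = y by [].
rewrite /a; case: xgetP => [w _ [Dw hw]|/(_ y)]; last by case.
by apply: hD => //; rewrite inE.
Qed.

Lemma sigma_complete_bound d (G : porderType d) (s : nat -> G) :
  up_directed G -> sigma_complete G -> exists t, forall n, (s n <= t)%O.
Proof.
move=> [_ dG] sG.
have [b bP] := choice (fun st : G * G => dG st.1 st.2).
pose v := fix v n := if n is m.+1 then b (v m, s n) else s 0%N.
have v_nd : nondecreasing_seq v.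
  by apply/nondecreasing_seqP => n; exact: (bP (v n, s n.+1)).1.
have [t [tv _]] := sG v v_nd; exists t => n.
apply: (@le_trans _ _ (v n)); last by apply: tv; exists n.
by case: n => [//|n]; exact: (bP (v n, s n.+1)).2.
Qed.

Section Conclusion.
Context {R : realType} (X : completeNormedModType R).

(** All normalized [a n] lie in the range of a single retraction; a functional is
    thus approximated, uniformly at these vectors, by one of countably many, and
    the norm of a functional on [U] is computed along the [a n]. *)
Theorem retractional_skeletons_asplund :
  (forall N : equivalent_norm X,
     has_retractional_skeleton R (@bidual_ball R (renorm N))) ->
  asplund X.
Proof.
move=> skN U cU sU.
have U0 : [set` U] 0 by exact: rpred0.
have [a [aU a_dense]] := dense_sequence U0 sU.
have [xs xsP] := choice (fun n => norming_functional (a n)).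
pose xs1 n := (xsP n).2; pose xsa n := (xsP n).1.
pose N := exposing_norm a xs1.
pose V := renorm N.
have [d [G [r rsk]]] := skN N.
pose x n : V := (rnorm a xs (a n))^-1 *: (a n : V).
have nE (u : V) : `|u| = rnorm a xs u by [].
have x1 n : a n != 0 -> `|x n| = 1.
  move=> an0; rewrite /x normrZ -nE normfV normr_id mulVf// nE.
  by apply: contra_neq an0 => /(rnorm0 xs1).
have x_le1 n : `|x n| <= 1.
  have [an0|/x1->//] := eqVneq (a n) 0.
  by rewrite /x an0 scaler0 normr0.
have xU n : (x n : X) \in U by apply: rpredZ; exact: aU.
have [F FE] : exists F : nat -> @dual_ball R (dual V) 1, forall n z, ev (F n) z = z (x n).
  suff h n : exists F : @dual_ball R (dual V) 1, forall z, ev F z = z (x n).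
    by have [F FE] := choice h; exists F.
  apply: ball_of => // z; rewrite (le_trans (dual_normP' z _))// ler_piMr//.
have Fs n : exists s, a n != 0 -> r s (F n) = F n.
  have [an0|an0] := eqVneq (a n) 0; first by have [[s0] _] := rsk_directed rsk; exists s0.
  have [||g gP] := @unit_vector_determined R X a xs xs1 xsa (x n : X).
  - exact: x1.
  - by move=> e e0; exact: a_dense (xU n) e0.
  have [|s sF] := determined_in_range (F := F n) (g := g) rsk.
    move=> F' F'g; apply: ev_eq => z; rewrite FE; apply: gP => [|k].
      exact: ev_norm.
    by rewrite -[LHS]/(ev F' (g k)) F'g FE.
  by exists s.
have [s sP] := choice Fs.
have [t st] := sigma_complete_bound s (rsk_directed rsk) (rsk_sigma_complete rsk).
pose S := range (r t).
have SF n : a n != 0 -> S (F n).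
  move=> an0; exists (F n) => //.
  have := congr1 (fun f => f (F n)) (rsk_compat rsk (st n)).2.
  by rewrite /= sP.
have cS : compact [set: S].
  apply: compact_set_type; apply: continuous_compact.
    by apply: continuous_subspaceT; exact: (rsk_continuous rsk).
  by apply: compact_set_type; exact: banach_alaoglu.
have evS_cont (z : dual V) : continuous (fun y : S => ev (val y) z).
  move=> y; apply: (@continuous_comp S (@dual_ball R (dual V) 1) R
     (fun y : S => val y) (fun F => ev F z)).
    exact: initial_continuous.
  exact: ev_continuous.
have net k : exists D : set (dual V), countable D /\ forall z : dual V, exists2 z', D z' &
    forall n, a n != 0 -> `|z (x n) - z' (x n)| <= k.+1%:R^-1.
  have [|D cD DP] := compact_metrizable_separable cS (rsk_metrizable rsk t)
    evS_cont (e := k.+1%:R^-1).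
    by [].
  exists D; split => // z; have [z' Dz' zz'] := DP z; exists z' => // n an0.
  by have := zz' (exist _ (F n) (mem_set (SF n an0))); rewrite /= !FE.
have [D DP] := choice net.
have [rst rstE] : exists rst : dual V -> dual (subspace_of U), forall z u,
    rst z u = z (val u : V).
  suff h (z : dual V) : exists f : dual (subspace_of U), forall u, f u = z (val u : V).
    by have [rst rstE] := choice h; exists rst.
  apply: (@dual_of _ _ _ (`|z| * 3)) => [b u v|u]; first by rewrite -linearP.
  apply: le_trans (dual_normP' z _) _; rewrite -mulrA ler_wpM2l//.
  by have /andP[] := rnorm_bound a xs1 (val u).
exists (rst @` \bigcup_k D k); split => //.
  apply: card_le_trans (card_image_le _ _) _.
  by apply: bigcup_countable => // k _; exact: (DP k).1.
move=> f _ W; rewrite -nbhs_ballE => -[e /= e0 eW].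
have [z zf] : exists z : dual V, forall u : subspace_of U, z (val u : V) = f u.
  have [|||f0 [f0E _]] := @hahn_banach R X
      [set p | exists u : subspace_of U, p = (val u, f u)] `|f| (normr_ge0 _).
  - by exists 0; rewrite (linear0 f).
  - move=> b _ _ [u ->] [v ->]; exists (b *: u + v); rewrite (linearP f).
    by [].
  - by move=> _ [u ->] /=; rewrite (le_trans (ler_norm _))// dual_normP'.
  have [z zE] := dual_to_renorm a xs1 f0; exists z => u.
  by rewrite zE; have /= := f0E (val u, f u); apply; exists u.
(* The norms differ by a factor at most 3, so [e / 6] yields [e / 2] below. *)
have e60 : 0 < e / 6 by rewrite divr_gt0.
have [k ke] := exists_invS_le e60.
have [z' Dz' zz'] := (DP k).2 z.
exists (rst z'); split; first by exists z' => //; exists k.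
apply: eW; rewrite -ball_normE /=.
have zza n : `|(z - z') (a n : V)| <= e / 2 * `|a n|.
  have [->|an0] := eqVneq (a n) 0; first by rewrite linear0 !normr0 mulr0.
  have an : (a n : V) = rnorm a xs (a n) *: x n.
    rewrite /x scalerA divff ?scale1r//.
    by apply: contra_neq an0 => /(rnorm0 xs1).
  rewrite [in leLHS]an linearZ /= normrM.
  have /andP[a0 a3] := rnorm_bound a xs1 (a n).
  rewrite ger0_norm; last by rewrite (le_trans _ a0)// mulr_ge0.
  apply: (@le_trans _ _ (3 * `|a n| * (e / 6))).
    apply: ler_pM => //; first by rewrite (le_trans _ a0)// mulr_ge0.
    exact: le_trans (zz' n an0) ke.
  rewrite mulrC mulrA (_ : e / 6 * 3 = e / 2)//.
  by rewrite (_ : 6 = 2 * 3 :> R) ?invfM ?mulrA ?divfK // -natrM.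
have zzu (u : subspace_of U) : `|(z - z') (val u : V)| <= e / 2 * `|u|.
  apply/ler_addgt0Pr => eta eta0.
  pose c := e / 2 + `|z - z'| * 3.
  have c0 : 0 < c by rewrite ltr_pwDl ?divr_gt0// mulr_ge0.
  have [n un] := a_dense (val u) _ (subspace_valP u) (divr_gt0 eta0 c0).
  rewrite (_ : (z - z') (val u : V) =
      (z - z') (a n : V) + (z - z') (val u - a n : V)); last first.
    by rewrite -linearD /= [a n + _]addrC subrK.
  apply: le_trans (ler_normD _ _) _.
  apply: (@le_trans _ _ (e / 2 * (`|u| + `|val u - a n|) +
      `|z - z'| * (3 * `|val u - a n|))).
    apply: lerD; last first.
      apply: le_trans (dual_normP' _ _) _; rewrite ler_wpM2l//.
      by have /andP[] := rnorm_bound a xs1 (val u - a n).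
    apply: le_trans (zza n) _; rewrite ler_wpM2l ?divr_ge0 ?(ltW e0)//.
    by rewrite -[a n](subKr (val u)) (le_trans (ler_normB _ _))// subKr.
  rewrite mulrDr -addrA lerD2l mulrA -mulrDl mulrC -ler_pdivlMr//.
  exact: ltW.
apply: (@le_lt_trans _ _ (e / 2)); last by rewrite ltr_pdivrMr// ltr_pMr// ltr1n.
apply: dual_norm_le => [|u]; first by rewrite divr_ge0// ltW.
rewrite (_ : (f - rst z') u = (z - z') (val u : V)); first exact: zzu.
by rewrite -[LHS]/(f u - rst z' u) rstE -zf.
Qed.
End Conclusion.

Theorem theorem5p3 (R : realType) (X : completeNormedModType R) :
  [<-> asplund X;
       forall N : equivalent_norm X,
         has_projectional_skeleton (dual (renorm N)) 1;
       forall N : equivalent_norm X,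
         has_retractional_skeleton R (bidual_ball (renorm N))].
Proof.
tfae=> [aX N|skP N|].
- by apply: fragmented_skeleton => M; exact: asplund_fragmented.
- exact: dual_retractional_skeleton (skP N).
- exact: retractional_skeletons_asplund.
Qed.
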